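(* Let $(\mathcal U,U,V)$ be a metric $f$-structure. Let $\mathscr V$ be a real vector space and $\psi\colon\mathscr V\to V^+$ a symmetric, sublinear map. Then there exists a unique couple $(\mathscr M_{\langle\psi\rangle},T_{\langle\psi\rangle})$, where $\mathscr M_{\langle\psi\rangle}$ is a $V$-Banach $U$-module and $T_{\langle\psi\rangle}\colon\mathscr V\to\mathscr M_{\langle\psi\rangle}$ is linear, such that: (i) $|T_{\langle\psi\rangle}\mathsf v|=\psi(\mathsf v)$ for every $\mathsf v\in\mathscr V$; (ii) $\mathscr G(T_{\langle\psi\rangle}(\mathscr V))$ is dense in $\mathscr M_{\langle\psi\rangle}$. Uniqueness is up to unique isomorphism: given another couple $(\mathscr M,T)$ with the same properties, there exists a unique isomorphism of $V$-Banach $U$-modules $\Phi\colon\mathscr M_{\langle\psi\rangle}\to\mathscr M$ such that $\Phi\circ T_{\langle\psi\rangle}=T$.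
   Context: Riesz spaces and $f$-algebras. $\mathbb R^+=[0,\infty)$. A Riesz space is a real vector space $U$ with a partial order that is a lattice and satisfies $u\le v\Rightarrow u+w\le v+w$ and ($u\ge 0$, $\lambda\in\mathbb R^+$) $\Rightarrow\lambda u\ge 0$; $\vee,\wedge$ denote sup and inf of two elements, $u^{+}=u\vee 0$, $u^-=(-u)\vee 0$, $|u|=u\vee(-u)$, $U^+=\{u\in U:u\ge 0\}$. A Riesz subspace is a linear subspace closed under $\vee,\wedge$; a Riesz subspace $V\subset U$ is solid if $v\in U$, $u\in V$, $|v|\le|u|$ imply $v\in V$. A family is disjoint if $|u|\wedge|v|=0$ for any two different members. Dedekind $\sigma$-complete: every countable non-empty subset bounded above has a supremum and every countable non-empty subset bounded below has an infimum. An $f$-algebra is a Riesz space with an associative, commutative, $\mathbb R$-bilinear multiplication with unit $\mathbf 1_U$ such that $uv\ge0$ for $u,v\ge 0$, and $(uw)\wedge v=0$ whenever $u\wedge v=0$ and $w\ge 0$. An $f$-subalgebra is a Riesz subspace closed under multiplication and containing $\mathbf 1_U$. $\mathrm{Idem}(U)=\{u\in U:u^2=u\}$. A finite partition of $u\in\mathrm{Idem}(U)$ is a finite disjoint family in $\mathrm{Idem}(U)$ with sum $u$; a countable partition of $u$ is a disjoint family $(u_n)_{n\in\mathbb N}\subset\mathrm{Idem}(U)$ with $\sup_n u_n=u$; $\mathcal P(u)$ is the set of countable partitions of $u$. Simple elements: $\mathcal S(U)=\{\sum_{i=1}^n\lambda_iu_i:\lambda_i\in\mathbb R,\ (u_i)_{i=1}^n\text{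 a finite partition of }\mathbf 1_U\}$. An order-preserving map is $\sigma$-order-continuous if it preserves existing suprema of non-decreasing sequences and existing infima of non-increasing sequences. A localisable $f$-algebra is a Dedekind $\sigma$-complete $f$-algebra whose multiplication is $\sigma$-order-continuous on $U^+\times U^+$ and such that every $u\in U^+$ is the supremum of a non-decreasing sequence in $\mathcal S(U)\cap U^+$. Metric notions (products of metric spaces carry the sum distance). A metric Riesz space $(U,\mathsf d_U)$ is a Dedekind $\sigma$-complete Riesz space with a complete distance such that $\mathsf d_U(u,0)=\mathsf d_U(|u|,0)$, $\mathsf d_U(u+w,v+w)=\mathsf d_U(u,v)$, and $\mathsf d_U(u,0)\le\mathsf d_U(v,0)$ whenever $0\le u\le v$. A metric $f$-algebra is a localisable $f$-algebra $U$ with a distance $\mathsf d_U$ such that $(U,\mathsf d_U)$ is a metric Riesz space, the multiplication $U\times U\to U$ is continuous, $\mathcal S(U)$ is dense, and $\mathsf d_U(\varepsilon\mathbf 1_U,0)\to0$ as $\varepsilon\searrow0$. A metric $f$-structure is a triple $(\mathcal U,U,V)$ where $\mathcal U$ is a localisable $f$-algebra; $(U,\mathsf d_U)$ is a metric $f$-algebra that is a solid $f$-subalgebra of $\mathcal U$; $(V,\mathsf d_V)$ is a metric Riesz space that is a solid Riesz subspace of $\mathcal U$; $UV=V$ (where $UV=\{uv:u\in U,v\in V\}$) and the multiplication $U\times V\to V$ is continuous; and for any $(u_n)_n\in\mathcal P(\mathbf 1_U)$ and $\varepsilon>0$ there is $\delta>0$ such that, whenever $(v_n)_n\subset V^+$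 satisfies $\sum_n\mathsf d_V(u_nv_n,0)\le\delta$, the family $(u_nv_n)_n$ is order-bounded in $V$ and $\mathsf d_V(\sup_nu_nv_n,0)\le\varepsilon$. Modules. A $V$-normed $U$-module is a $U$-module $\mathscr M$ (a real vector space via $\lambda v=(\lambda\mathbf 1_U)\cdot v$) with a map $|\cdot|\colon\mathscr M\to V^+$ such that $|v|=0\iff v=0$, $|v+w|\le|v|+|w|$, $|u\cdot v|=|u||v|$, and the glueing property holds: if $(u_n)_n\in\mathcal P(\mathbf 1_U)$ and $(v_n)_n\subset\mathscr M$ are such that $(|u_n\cdot v_n|)_n$ is order-bounded in $V$ (one writes $(u_n,v_n)_n\in\mathrm{Adm}(\mathscr M)$), then there is a (necessarily unique) $v\in\mathscr M$ with $u_n\cdot v=u_n\cdot v_n$ for all $n$, denoted $\sum_{n\in\mathbb N}u_n\cdot v_n$. $\mathscr M$ has the distance $\mathsf d_{\mathscr M}(v,w)=\mathsf d_V(|v-w|,0)$; if it is complete, $\mathscr M$ is a $V$-Banach $U$-module. For $\varnothing\ne S\subset\mathscr M$, $\mathscr G(S)=\{\sum_nu_n\cdot v_n:(u_n)_n\in\mathcal P(\mathbf 1_U),(v_n)_n\subset S,(u_n,v_n)_n\in\mathrm{Adm}(\mathscr M)\}$. An isomorphism of $V$-Banach $U$-modules is a $U$-linear bijection $\Phi$ with $|\Phi v|=|v|$ for all $v$ (i.e. an invertible morphism in the category whose morphisms are the $U$-linear maps $T$ with $|Tv|\le|v|$). A map $\psi\colon\mathscr V\to V^+$ is sublinear if $\psi(\lambda\mathsf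 v)=\lambda\psi(\mathsf v)$ for $\lambda\in\mathbb R^+$ and $\psi(\mathsf v+\mathsf w)\le\psi(\mathsf v)+\psi(\mathsf w)$; it is symmetric if $\psi(-\mathsf v)=\psi(\mathsf v)$. *)

(* Defs.v *)
From HB Require Import structures.
From mathcomp Require Import all_boot all_order all_algebra.
From mathcomp Require Import all_classical all_reals all_analysis.
Import numFieldNormedType.Exports.

Set Implicit Arguments.
Unset Strict Implicit.
Unset Printing Implicit Defensive.

Import Order.TTheory GRing.Theory Num.Theory.
Local Open Scope classical_set_scope.
Local Open Scope ring_scope.

(* `completeType` would also require a distinguished point. *)
Definition complete_space (T : uniformType) : Prop :=
  forall F : set_system T, ProperFilter F -> cauchy F ->
    exists l : T, F --> l.

(* Hierarchy-Builder rejects a new structure joining GRing.Zmodule with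
   PseudoMetric, with Order.Lattice or, if ordered, with GRing.PzRing, because
   Num.RealDomain and PseudoMetricNormedZmod already join them. So the lattice
   operations, product and distance of the structures below are fields of their
   own, and the library's metric and ring structures are put on copies of the
   carrier, `dist_space` and `falg_ring`. *)

Record distance (R : realType) (T : choiceType) := Distance {
  dist :> T -> T -> R ;
  dist_xx : forall x, dist x x = 0 ;
  dist_eq0 : forall x y, dist x y = 0 -> x = y ;
  dist_sym : forall x y, dist x y = dist y x ;
  dist_triangle : forall y x z, dist x z <= dist x y + dist y z
}.

Definition dist_space (R : realType) (T : choiceType) (d : distance R T) :
  Type := T.

HB.instance Definition _ (R : realType) (T : choiceType) (d : distance R T) :=
  Choice.copy (dist_space d) T.

HB.instance Definition _ (R : realType) (T : choiceType) (d : distance R T) :=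
  isMetric.Build R (dist_space d)
    (@dist_xx R T d) (@dist_eq0 R T d) (@dist_sym R T d) (@dist_triangle R T d).

HB.mixin Record POrderedZmodule_isRiesz (R : realType) U
    & GRing.Lmodule R U & Num.POrderedZmodule U := {
  rjoin : U -> U -> U ;
  rmeet : U -> U -> U ;
  rjoinP : forall u v : U, supremums [set u; v] (rjoin u v) ;
  rmeetP : forall u v : U, infimums [set u; v] (rmeet u v) ;
  riesz_leD : forall u v w : U, u <= v -> u + w <= v + w ;
  riesz_scale_ge0 : forall (a : R) (u : U), 0 <= a -> 0 <= u -> 0 <= a *: u
}.

#[short(type="rieszType")]
HB.structure Definition Riesz (R : realType) :=
  {U of GRing.Lmodule R U & Num.POrderedZmodule U
      & POrderedZmodule_isRiesz R U}.

HB.mixin Record Riesz_isFAlgebra (R : realType) U & Riesz R U := {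
  fone : U ;
  fmul : U -> U -> U ;
  fmulA : associative fmul ;
  fmulC : commutative fmul ;
  fmul1l : left_id fone fmul ;
  fmulDl : left_distributive fmul +%R ;
  fmulZl : forall (a : R) (u v : U), fmul (a *: u) v = a *: fmul u v ;
  fmul_ge0 : forall u v : U, 0 <= u -> 0 <= v -> 0 <= fmul u v ;
  fmul_disjoint : forall u v w : U,
    rmeet u v = 0 -> 0 <= w -> rmeet (fmul u w) v = 0
}.

#[short(type="fAlgType")]
HB.structure Definition FAlgebra (R : realType) :=
  {U of Riesz R U & Riesz_isFAlgebra R U}.

(* The commutative ring underlying an f-algebra, over which modules are taken.
   It may be trivial (1 = 0), whence `comPzRingType`. *)
Definition falg_ring (R : realType) (U : fAlgType R) : Type := U.

HB.instance Definition _ (R : realType) (U : fAlgType R) :=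
  GRing.Zmodule.copy (falg_ring U) U.

HB.instance Definition _ (R : realType) (U : fAlgType R) :=
  GRing.Zmodule_isComPzRing.Build (falg_ring U)
    (@fmulA R U) (@fmulC R U) (@fmul1l R U) (@fmulDl R U).

Section RieszNotions.
Context {R : realType} {U : rieszType R}.
Implicit Types (u v : U) (A : set U).

Definition rabs u : U := rjoin u (- u).

Lemma rabsN u : rabs (- u) = rabs u.
Proof.
rewrite /rabs opprK; apply: (is_subset1_supremums (A := [set u; - u])).
  by rewrite setUC; exact: rjoinP.
exact: rjoinP.
Qed.

Definition disjoint_family (I : Type) (u : I -> U) : Prop :=
  forall i j, i <> j -> rmeet (rabs (u i)) (rabs (u j)) = 0.

Definition solid A : Prop :=
  forall u v, A u -> rabs v <= rabs u -> A v.

Definition order_bounded A : Prop := has_ubound A /\ has_lbound A.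

End RieszNotions.

Definition dedekind_sigma_complete (R : realType) (U : rieszType R) : Prop :=
  (forall A : set U,
    countable A -> A !=set0 -> has_ubound A -> supremums A !=set0) /\
  (forall A : set U,
    countable A -> A !=set0 -> has_lbound A -> infimums A !=set0).

(* Suprema and infima in the domain are taken in the ordered set D. *)
Definition sigma_order_continuous d d' (P : porderType d) (Q : porderType d')
    (D : set P) (f : P -> Q) : Prop :=
  [/\ forall p q, D p -> D q -> (p <= q)%O -> (f p <= f q)%O,
      forall (p : nat -> P) (x : P), (forall n, D (p n)) ->
        nondecreasing_seq p ->
        (D `&` ubound (range p)) x -> lbound (D `&` ubound (range p)) x ->
        supremums (range (f \o p)) (f x)
    & forall (p : nat -> P) (x : P), (forall n, D (p n)) ->
        nonincreasing_seq p ->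
        (D `&` lbound (range p)) x -> ubound (D `&` lbound (range p)) x ->
        infimums (range (f \o p)) (f x)].

Section FAlgebraNotions.
Context {R : realType} {U : fAlgType R}.
Implicit Types u : U.

Definition idem u : Prop := fmul u u = u.

Definition finite_partition (n : nat) (w : 'I_n -> U) u : Prop :=
  [/\ forall i, idem (w i), disjoint_family w & \sum_(i < n) w i = u].

Definition countable_partition (w : nat -> U) u : Prop :=
  [/\ forall n, idem (w n), disjoint_family w & supremums (range w) u].

Definition simple : set U :=
  [set u | exists (n : nat) (a : 'I_n -> R) (w : 'I_n -> U),
    finite_partition w fone /\ u = \sum_(i < n) a i *: w i].

End FAlgebraNotions.

HB.mixin Record Riesz_isDedekind (R : realType) U & Riesz R U := {
  riesz_dedekind : dedekind_sigma_complete U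
}.

HB.mixin Record FAlgebra_isLocalisable (R : realType) U & FAlgebra R U := {
  locfalg_mul_continuous :
    sigma_order_continuous [set p : (U *p U)%type | 0 <= p.1 /\ 0 <= p.2]
      (fun p => fmul p.1 p.2) ;
  locfalg_approx : forall u : U, 0 <= u ->
    exists s : nat -> U,
      [/\ forall n, simple (s n) /\ 0 <= s n, nondecreasing_seq s
        & supremums (range s) u]
}.

#[short(type="dedekindRieszType")]
HB.structure Definition DedekindRiesz (R : realType) :=
  {U of Riesz R U & Riesz_isDedekind R U}.

#[short(type="locFAlgType")]
HB.structure Definition LocFAlgebra (R : realType) :=
  {U of FAlgebra R U & Riesz_isDedekind R U & FAlgebra_isLocalisable R U}.

HB.mixin Record DedekindRiesz_isMetric (R : realType) U & DedekindRiesz R U := {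
  rdist : distance R U ;
  rdist_complete : complete_space (dist_space rdist) ;
  rdist_abs : forall u : U, rdist u 0 = rdist (rabs u) 0 ;
  rdistD : forall u v w : U, rdist (u + w) (v + w) = rdist u v ;
  rdist_le : forall u v : U, 0 <= u -> u <= v -> rdist u 0 <= rdist v 0
}.

#[short(type="metricRieszType")]
HB.structure Definition MetricRiesz (R : realType) :=
  {U of DedekindRiesz R U & DedekindRiesz_isMetric R U}.

Definition riesz_space (R : realType) (U : metricRieszType R) : metricType R :=
  dist_space (@rdist R U).

HB.mixin Record MetricRiesz_isFAlgebra (R : realType) U
    & LocFAlgebra R U & MetricRiesz R U := {
  mfalg_mul_continuous :
    continuous (fun p : riesz_space U * riesz_space U =>
      (fmul (p.1 : U) (p.2 : U) : riesz_space U)) ;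
  mfalg_simple_dense : dense (simple : set (riesz_space U)) ;
  mfalg_dist_scale1 :
    rdist (e *: (fone : U)) 0 @[e --> (0 : R)^'+] --> (0 : R)
}.

#[short(type="metricFAlgType")]
HB.structure Definition MetricFAlgebra (R : realType) :=
  {U of LocFAlgebra R U & MetricRiesz R U & MetricRiesz_isFAlgebra R U}.

(* A subspace of a Riesz space is given by a type together with an injective
   map preserving the structure: its range is the subspace. *)
Definition riesz_embedding (R : realType) (V U : rieszType R) (f : V -> U) :
    Prop :=
  [/\ injective f, linear f, {morph f : u v / rjoin u v}
    & {morph f : u v / rmeet u v}].

Definition falgebra_embedding (R : realType) (V U : fAlgType R) (f : V -> U) :
    Prop :=
  [/\ riesz_embedding f, {morph f : u v / fmul u v} & f fone = fone].

(* `mfs_act` is the product U x V -> V computed in the ambient algebra. *)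
Record metricFStructure (R : realType) := MetricFStructure {
  mfs_amb : locFAlgType R ;
  mfs_U : metricFAlgType R ;
  mfs_V : metricRieszType R ;
  mfs_inU : mfs_U -> mfs_amb ;
  mfs_inV : mfs_V -> mfs_amb ;
  mfs_act : mfs_U -> mfs_V -> mfs_V ;
  mfs_inU_embedding : falgebra_embedding mfs_inU ;
  mfs_inU_solid : solid (range mfs_inU) ;
  mfs_inV_embedding : riesz_embedding mfs_inV ;
  mfs_inV_solid : solid (range mfs_inV) ;
  mfs_UV : [set fmul (mfs_inU u) (mfs_inV v) | u in setT & v in setT] = range mfs_inV ;
  mfs_actE : forall u v, mfs_inV (mfs_act u v) = fmul (mfs_inU u) (mfs_inV v) ;
  mfs_act_continuous :
    continuous (fun p : riesz_space mfs_U * riesz_space mfs_V =>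
      (mfs_act p.1 p.2 : riesz_space mfs_V)) ;
  mfs_glue : forall (u : nat -> mfs_U) (e : R),
    countable_partition u fone -> 0 < e ->
    exists2 d : R, 0 < d &
      forall v : nat -> mfs_V, (forall n, 0 <= v n) ->
        (\sum_(0 <= n <oo) (rdist (mfs_act (u n) (v n)) 0)%:E <= d%:E)%E ->
        order_bounded (range (fun n => mfs_act (u n) (v n))) /\
        (exists2 s, supremums (range (fun n => mfs_act (u n) (v n))) s
           & rdist s 0 <= e)
}.

Local Notation "u *| v" := ((u : falg_ring _) *: v) (at level 40).

Definition admissible (R : realType) (S : metricFStructure R)
    (M : lmodType (falg_ring (mfs_U S))) (norm : M -> mfs_V S)
    (u : nat -> mfs_U S) (v : nat -> M) : Prop :=
  countable_partition u fone /\ order_bounded (range (fun n => norm (u n *| v n))).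

Record normedModule (R : realType) (S : metricFStructure R) := VNormedModule {
  nmod_carrier :> lmodType (falg_ring (mfs_U S)) ;
  nmod_norm : nmod_carrier -> mfs_V S ;
  nmod_norm_ge0 : forall v, 0 <= nmod_norm v ;
  nmod_norm_eq0 : forall v, nmod_norm v = 0 <-> v = 0 ;
  nmod_normD : forall v w, nmod_norm (v + w) <= nmod_norm v + nmod_norm w ;
  nmod_normZ : forall (u : mfs_U S) v, nmod_norm (u *| v) = mfs_act (rabs u) (nmod_norm v) ;
  nmod_glue : forall (u : nat -> mfs_U S) v, admissible nmod_norm u v ->
    exists w, forall n, u n *| w = u n *| v n
}.

Section NormedModuleDistance.
Context {R : realType} {S : metricFStructure R} (M : normedModule S).

Let ndist (v w : M) : R := rdist (nmod_norm (v - w)) 0.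

Let ndist_xx v : ndist v v = 0.
Proof. by rewrite /ndist subrr (nmod_norm_eq0 (0 : M)).2// dist_xx. Qed.

Let ndist_eq0 v w : ndist v w = 0 -> v = w.
Proof.
move=> /dist_eq0/nmod_norm_eq0 h.
by apply/eqP; rewrite -subr_eq0; apply/eqP.
Qed.

Let ndist_sym v w : ndist v w = ndist w v.
Proof.
rewrite /ndist -[v - w]opprB -[X in nmod_norm (- X)]scale1r.
by rewrite -scaleNr nmod_normZ rabsN -nmod_normZ scale1r.
Qed.

Let ndist_triangle w v x : ndist v x <= ndist v w + ndist w x.
Proof.
rewrite /ndist; set a := nmod_norm (v - w); set b := nmod_norm (w - x).
have le_ab : nmod_norm (v - x) <= a + b by rewrite -(subrKA w) nmod_normD.
apply: (le_trans (rdist_le _ _ (nmod_norm_ge0 _) le_ab)).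
apply: (le_trans (dist_triangle _ b _ _)).
by rewrite -(rdistD a 0 b) add0r.
Qed.

Definition nmod_dist : distance R M :=
  Distance ndist_xx ndist_eq0 ndist_sym ndist_triangle.

Definition nmod_space : metricType R := dist_space nmod_dist.

End NormedModuleDistance.

Record banachModule (R : realType) (S : metricFStructure R) := VBanachModule {
  bmod_normed :> normedModule S ;
  bmod_complete : complete_space (nmod_space bmod_normed)
}.

Definition glueings (R : realType) (S : metricFStructure R)
    (M : normedModule S) (A : set M) : set M :=
  [set w | exists (u : nat -> mfs_U S) (v : nat -> M),
    [/\ admissible (@nmod_norm _ _ M) u v, forall n, A (v n)
      & forall n, u n *| w = u n *| v n]].

Definition real_scale (R : realType) (S : metricFStructure R)
    (M : normedModule S) (a : R) (v : M) : M := (a *: (fone : mfs_U S)) *| v.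

Definition real_linear (R : realType) (S : metricFStructure R)
    (E : lmodType R) (M : normedModule S) (T : E -> M) : Prop :=
  forall (a : R) (x y : E), T (a *: x + y) = real_scale a (T x) + T y.

Definition module_isomorphism (R : realType) (S : metricFStructure R)
    (M N : banachModule S) (Phi : M -> N) : Prop :=
  [/\ linear Phi, bijective Phi
    & forall v, nmod_norm (Phi v) = nmod_norm v].

Definition sublinear (R : realType) (E : lmodType R) (V : rieszType R)
    (psi : E -> V) : Prop :=
  (forall (a : R) x, 0 <= a -> psi (a *: x) = a *: psi x) /\
  (forall x y, psi (x + y) <= psi x + psi y).

Definition generated_by (R : realType) (S : metricFStructure R)
    (E : lmodType R) (psi : E -> mfs_V S) (M : banachModule S) (T : E -> M) :
    Prop :=
  [/\ real_linear T, forall x, nmod_norm (T x) = psi x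
    & dense (glueings (range T) : set (nmod_space M))].

(* Main.v *)
Require Import Defs.
From HB Require Import structures.
From mathcomp Require Import all_boot all_order all_algebra.
From mathcomp Require Import all_classical all_reals all_analysis.
Import numFieldNormedType.Exports.

Set Implicit Arguments.
Unset Strict Implicit.
Unset Printing Implicit Defensive.

Import Order.TTheory GRing.Theory Num.Theory.
Local Open Scope classical_set_scope.
Local Open Scope ring_scope.

(** A countable partition of the unit cuts the space underlying the algebra [U]
    into countably many pieces, and everything below is checked piece by piece.
    This is legitimate because a partition separates points: an element of [U],
    of [V] or of a normed module that is killed by all the pieces is zero
    ([partition_separating], [act_separating], [nmod_separating]).  The
    inequalities of [V] can be tested in the same way ([piecewise_act_le]).

    Existence.  The glueings of vectors of [E] are step functions, taking a
    vector [e n] on the piece [p n], and the norm of such a function is the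
    element of [V] obtained by glueing the pieces of the [psi (e n)]
    ([simple_section_le]).  Step functions are encoded by honest functions from
    [U] to [E], so that they form a vector space on the nose.  Only the elements
    of [U] that are real on the pieces of a partition act on them, through real
    scalars, but those are dense in [U] ([loc_scalar_dense]).  The module is the
    completion of this seminormed group: Cauchy sequences modulo the sequences
    whose norm tends to zero.  An element [u] of [U], limit of [s n], sends the
    class of a sequence [a] to the class of the sequence [s n * a n]; the bound
    [pre_norm_scal_le] and the continuity of the product of [U] and [V] show
    that this is well defined, and the module axioms pass to the limit.

    The glueing property survives completion thanks to the last axiom of metric
    f-structures.  Members of an admissible family are approximated by step
    functions with errors so small that they glue in [V] into an element close
    to zero ([completion_glue_approx]); the approximations can be glued as step
    functions, and they form a Cauchy sequence whose limit is the glueing looked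
    for ([completion_glue]).

    Uniqueness.  Given two couples with the required properties, relate a vector
    of the first module to one of the second when, piece by piece, they are the
    images of the same vector of [E].  Both norms are then glued from the same
    values of [psi], so related vectors have the same norm, and the relation is
    linear.  By density and completeness its closure is defined everywhere on
    both sides and functional on both sides: it is the graph of an isomorphism
    ([generated_unique]).  Any isomorphism compatible with the two maps contains
    this relation in its graph, hence is the same one
    ([isomorphism_limit_pair]). *)

(** * Riesz spaces *)

Section RieszTheory.
Context {R : realType} {U : rieszType R}.
Implicit Types (u v w : U) (a : R).

Lemma rle_addr w u v : u <= v -> u + w <= v + w.
Proof. exact: riesz_leD. Qed.

Lemma rle_add u v u' v' : u <= v -> u' <= v' -> u + u' <= v + v'.
Proof.
move=> uv uv'; apply: (le_trans (rle_addr u' uv)).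
by rewrite ![v + _]addrC; exact: rle_addr.
Qed.

Lemma rsubr_ge0 u v : (0 <= v - u) = (u <= v).
Proof.
apply/idP/idP => [/(rle_addr u)|/(rle_addr (- u))].
  by rewrite add0r subrK.
by rewrite subrr.
Qed.

Lemma rle_opp u v : u <= v -> - v <= - u.
Proof. by rewrite -rsubr_ge0 -(rsubr_ge0 (- v)) opprK addrC. Qed.

Lemma radd_ge0 u v : 0 <= u -> 0 <= v -> 0 <= u + v.
Proof. by move=> u0 v0; rewrite -[0]addr0 rle_add. Qed.

Lemma rle_scale a u v : 0 <= a -> u <= v -> a *: u <= a *: v.
Proof.
by move=> a0 uv; rewrite -rsubr_ge0 -scalerBr riesz_scale_ge0// rsubr_ge0.
Qed.

Lemma rjoinl u v : u <= rjoin u v.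
Proof. by have [+ _] := rjoinP u v; apply; left. Qed.

Lemma rjoinr u v : v <= rjoin u v.
Proof. by have [+ _] := rjoinP u v; apply; right. Qed.

Lemma rjoin_le u v w : u <= w -> v <= w -> rjoin u v <= w.
Proof. by move=> uw vw; have [_] := rjoinP u v; apply=> x [->|->]. Qed.

Lemma rmeetl u v : rmeet u v <= u.
Proof. by have [+ _] := rmeetP u v; apply; left. Qed.

Lemma rmeetr u v : rmeet u v <= v.
Proof. by have [+ _] := rmeetP u v; apply; right. Qed.

Lemma rmeet_ge u v w : w <= u -> w <= v -> w <= rmeet u v.
Proof. by move=> uw vw; have [_] := rmeetP u v; apply=> x [->|->]. Qed.

Lemma rmeetC u v : rmeet u v = rmeet v u.
Proof. by apply/le_anti; rewrite !rmeet_ge// ?rmeetl ?rmeetr. Qed.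

Lemma rjoin_addr w u v : rjoin u v + w = rjoin (u + w) (v + w).
Proof.
apply/le_anti/andP; split; last first.
  by apply: rjoin_le; apply: rle_addr; [exact: rjoinl|exact: rjoinr].
rewrite -[leRHS](subrK w); apply: rle_addr; apply: rjoin_le.
  by rewrite -[leLHS](addrK w); apply: rle_addr; exact: rjoinl.
by rewrite -[leLHS](addrK w); apply: rle_addr; exact: rjoinr.
Qed.

Lemma rjoin_opp u v : rjoin (- u) (- v) = - rmeet u v.
Proof.
apply/le_anti/andP; split.
  by apply: rjoin_le; apply: rle_opp; [exact: rmeetl|exact: rmeetr].
rewrite -[leRHS]opprK; apply: rle_opp; apply: rmeet_ge.
  by rewrite -[leRHS]opprK; apply: rle_opp; exact: rjoinl.
by rewrite -[leRHS]opprK; apply: rle_opp; exact: rjoinr.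
Qed.

Lemma rjoin_idl u v : v <= u -> rjoin u v = u.
Proof. by move=> vu; apply/le_anti; rewrite rjoinl rjoin_le. Qed.

Lemma rmeet_idl u v : u <= v -> rmeet u v = u.
Proof. by move=> uv; apply/le_anti; rewrite rmeetl rmeet_ge. Qed.

Lemma rle_abs u : u <= rabs u. Proof. exact: rjoinl. Qed.

Lemma rle_absN u : - u <= rabs u. Proof. exact: rjoinr. Qed.

Lemma rabs_ge0 u : 0 <= rabs u.
Proof.
have h : 0 <= rabs u + rabs u.
  by rewrite -(subrr u) rle_add ?rle_abs ?rle_absN.
rewrite -[rabs u]scale1r (splitr 1) scalerDl -scalerDr.
by rewrite riesz_scale_ge0// ltW.
Qed.

Lemma rabs_le u v : u <= v -> - u <= v -> rabs u <= v.
Proof. exact: rjoin_le. Qed.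

Lemma ger0_rabs u : 0 <= u -> rabs u = u.
Proof.
move=> u0; apply: rjoin_idl; apply: (le_trans _ u0).
by rewrite -oppr0 rle_opp.
Qed.

Lemma rabs0 : rabs (0 : U) = 0. Proof. by rewrite ger0_rabs. Qed.

Lemma rabs_eq0 u : rabs u = 0 -> u = 0.
Proof.
move=> u0; apply/le_anti; rewrite -{1}u0 rle_abs -[0]oppr0 -[u]opprK.
by rewrite rle_opp// -u0 rle_absN.
Qed.

Lemma rabsD u v : rabs (u + v) <= rabs u + rabs v.
Proof.
by apply: rabs_le; rewrite ?opprD rle_add// ?rle_abs ?rle_absN.
Qed.

Lemma rabs_scale a u : rabs (a *: u) = `|a| *: rabs u.
Proof.
wlog a0 : a / 0 <= a => [wl|].
  have [/wl//|/ltW a0] := leP 0 a.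
  by rewrite -rabsN -scaleNr wl ?oppr_ge0// normrN.
rewrite (ger0_norm a0); apply/le_anti/andP; split.
  by apply: rabs_le; rewrite -?scalerN rle_scale// ?rle_abs ?rle_absN.
have [->|an0] := eqVneq a 0; first by rewrite !scale0r rabs_ge0.
have ai0 : 0 <= a^-1 by rewrite invr_ge0.
rewrite -[leRHS]scale1r -(divff an0) -scalerA rle_scale// rabs_le//.
  by rewrite -[leLHS]scale1r -(mulVf an0) -scalerA rle_scale// rle_abs.
by rewrite -[leLHS]scale1r -(mulVf an0) -scalerA rle_scale// scalerN rle_absN.
Qed.

Lemma rjoinC u v : rjoin u v = rjoin v u.
Proof. by apply/le_anti; rewrite !rjoin_le// ?rjoinl ?rjoinr. Qed.

Lemma rjoin_addm u v : rjoin u v + rmeet u v = u + v.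
Proof.
apply/eqP; rewrite -[rmeet u v]opprK subr_eq -rjoin_opp.
rewrite [_ + rjoin _ _]addrC rjoin_addr.
by rewrite addKr addrCA addNr addr0 rjoinC.
Qed.

Lemma rpos_decomp u : u = rjoin u 0 - rjoin (- u) 0.
Proof.
apply/eqP; rewrite eq_sym subr_eq addrC rjoin_addr addNr add0r.
by rewrite rjoinC.
Qed.

Lemma rpos_disjoint u : rmeet (rjoin u 0) (rjoin (- u) 0) = 0.
Proof.
apply/le_anti/andP; split; last by rewrite rmeet_ge// rjoinr.
set p := rjoin u 0; set q := rjoin (- u) 0; set m := rmeet p q.
(* Removing the common part of p and q leaves an upper bound of u and 0. *)
have pm : rjoin u 0 <= p - m.
  apply: rjoin_le; last by rewrite rsubr_ge0 rmeetl.
  by rewrite {1}(rpos_decomp u) -/p -/q rle_add// rle_opp// rmeetr.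
by rewrite -rsubr_ge0 sub0r -(addKr p (- m)) addrC rsubr_ge0.
Qed.

Lemma rjoin_sub_disjoint u v : rmeet u v = 0 -> rjoin (u - v) 0 = u.
Proof.
move=> uv; transitivity (u - rmeet u v); last by rewrite uv subr0.
by rewrite -rjoin_opp [RHS]addrC rjoin_addr addNr [- v + u]addrC rjoinC.
Qed.

(** The two parts of [u] are disjoint, so their sum is their supremum. *)
Lemma rabs_pos u : rabs u = rjoin u 0 + rjoin (- u) 0.
Proof.
apply/le_anti/andP; split.
  apply: rabs_le.
    by rewrite -[leLHS]addr0 rle_add ?rjoinl ?rjoinr.
  by rewrite -[leLHS]add0r rle_add ?rjoinl ?rjoinr.
rewrite -rjoin_addm rpos_disjoint addr0.
by rewrite !rjoin_le ?rle_abs ?rle_absN ?rabs_ge0.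
Qed.

Lemma rle_subLR u v w : (u - v <= w) = (u <= w + v).
Proof. by rewrite -[LHS]rsubr_ge0 -[RHS]rsubr_ge0 opprB addrA. Qed.

Lemma norm_sub_le (G : zmodType) (N : G -> U) :
  (forall x y, N (x + y) <= N x + N y) -> (forall x, N (- x) = N x) ->
  forall x y, rabs (N x - N y) <= N (x - y).
Proof.
move=> ND NN x y; apply: rabs_le; rewrite ?opprB rle_subLR.
  by rewrite -{1}(subrK y x).
by rewrite -[N (x - y)]NN opprB -{1}(subrK x y).
Qed.

End RieszTheory.

(** * Idempotents and countable partitions in an f-algebra *)

Section FAlgebraTheory.
Context {R : realType} {U : fAlgType R}.
Local Notation "u ** v" := (fmul u v) (at level 40, left associativity).
Implicit Types (u v w x : U) (p q : nat -> U) (Q : set U).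

Lemma fmulDr u v w : u ** (v + w) = u ** v + u ** w.
Proof. by rewrite fmulC fmulDl !(fmulC u). Qed.

Lemma fmulZr (a : R) u v : u ** (a *: v) = a *: (u ** v).
Proof. by rewrite fmulC fmulZl fmulC. Qed.

Lemma fmul1r u : u ** fone = u.
Proof. by rewrite fmulC fmul1l. Qed.

Lemma fmul0l u : 0 ** u = 0.
Proof. by rewrite -{1}(scale0r (0 : U)) fmulZl scale0r. Qed.

Lemma fmul0r u : u ** 0 = 0.
Proof. by rewrite fmulC fmul0l. Qed.

Lemma fmulNr u v : u ** (- v) = - (u ** v).
Proof. by rewrite -scaleN1r fmulZr scaleN1r. Qed.

Lemma fmulBr u v w : u ** (v - w) = u ** v - u ** w.
Proof. by rewrite fmulDr fmulNr. Qed.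

Lemma fmulBl u v w : (v - w) ** u = v ** u - w ** u.
Proof. by rewrite fmulC fmulBr !(fmulC u). Qed.

Lemma fmulAC u v w : u ** v ** w = u ** w ** v.
Proof. by rewrite -fmulA (fmulC v) fmulA. Qed.

Lemma fmulACA u v w x : u ** v ** (w ** x) = u ** w ** (v ** x).
Proof. by rewrite fmulA (fmulAC u) -fmulA. Qed.

Lemma fmul_sumr n u (f : 'I_n -> U) :
  u ** (\sum_(i < n) f i) = \sum_(i < n) u ** f i.
Proof.
elim: n f => [|n IH] f; first by rewrite !big_ord0 fmul0r.
by rewrite !big_ord_recl fmulDr IH.
Qed.

Lemma fmul_le w u v : 0 <= w -> u <= v -> w ** u <= w ** v.
Proof.
by move=> w0 uv; rewrite -rsubr_ge0 -fmulBr fmul_ge0// rsubr_ge0.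
Qed.

(** Multiplication by [w] keeps the positive and negative parts of [u]
    disjoint, and a difference of disjoint positive elements has them as
    its parts. *)
Lemma fmul_rjoin0 w u : 0 <= w -> rjoin (w ** u) 0 = w ** rjoin u 0.
Proof.
move=> w0; rewrite {1}(rpos_decomp u) fmulBr rjoin_sub_disjoint//.
rewrite !(fmulC w); apply: fmul_disjoint => //; rewrite rmeetC.
by apply: fmul_disjoint => //; rewrite rmeetC; exact: rpos_disjoint.
Qed.

Lemma rabs_fmul_pos w u : 0 <= w -> rabs (w ** u) = w ** rabs u.
Proof.
by move=> w0; rewrite !rabs_pos -fmulNr !fmul_rjoin0// fmulDr.
Qed.

(** The axiom on disjoint elements, used for each factor in turn, makes the
    product disjoint from itself. *)
Lemma disjoint_fmul u v : 0 <= u -> 0 <= v -> rmeet u v = 0 -> u ** v = 0.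
Proof.
move=> u0 v0 uv.
have /(fmul_disjoint)/(_ u0) : rmeet v (u ** v) = 0.
  by rewrite rmeetC; apply: fmul_disjoint.
by rewrite fmulC rmeet_idl.
Qed.

(** The cross terms vanish because the two parts of [u] are disjoint. *)
Lemma fsqr_ge0 u : 0 <= u ** u.
Proof.
have := rpos_disjoint u; rewrite (rpos_decomp u).
set a := rjoin u 0; set b := rjoin (- u) 0 => _.
have a0 : 0 <= a := rjoinr _ _; have b0 : 0 <= b := rjoinr _ _.
have ab : a ** b = 0 by apply: disjoint_fmul; [..|exact: rpos_disjoint].
rewrite fmulBr !fmulBl (fmulC b a) ab subr0 sub0r opprK.
by rewrite radd_ge0 ?fmul_ge0.
Qed.

Lemma idem0 : idem (0 : U). Proof. exact: fmul0r. Qed.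

Lemma idem1 : idem (fone : U). Proof. exact: fmul1r. Qed.

Lemma idem_ge0 u : idem u -> 0 <= u.
Proof. by move=> <-; exact: fsqr_ge0. Qed.

Lemma idem_compl u : idem u -> idem (fone - u).
Proof.
by move=> iu; rewrite /idem fmulBr fmul1r fmulBl fmul1l iu subrr subr0.
Qed.

Lemma idem_le1 u : idem u -> u <= fone.
Proof. by move/idem_compl/idem_ge0; rewrite rsubr_ge0. Qed.

Lemma idemM u v : idem u -> idem v -> idem (u ** v).
Proof. by move=> iu iv; rewrite /idem fmulACA iu iv. Qed.

Lemma idem_absorb u x : idem u -> 0 <= x -> x <= u -> u ** x = x.
Proof.
move=> iu x0 xu; apply/eqP; rewrite eq_sym -subr_eq0; apply/eqP.
rewrite -{1}(fmul1l x) -fmulBl; apply/le_anti; apply/andP; split; last first.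
  by rewrite fmul_ge0// idem_ge0//; exact: idem_compl.
apply: (le_trans (fmul_le (idem_ge0 (idem_compl iu)) xu)).
by rewrite fmulBl fmul1l iu subrr.
Qed.

Lemma idem_disjointP u v :
  idem u -> idem v -> rmeet (rabs u) (rabs v) = 0 <-> u ** v = 0.
Proof.
move=> iu iv; have u0 := idem_ge0 iu; have v0 := idem_ge0 iv.
rewrite !ger0_rabs//; split; first exact: disjoint_fmul.
move=> uv; have m0 : 0 <= rmeet u v by rewrite rmeet_ge.
rewrite -(idem_absorb iu m0 (rmeetl _ _)) -(idem_absorb iv m0 (rmeetr _ _)).
by rewrite fmulA uv fmul0l.
Qed.

Lemma idem_fmul_le u x : idem u -> 0 <= x -> u ** x <= x.
Proof.
move=> iu x0; rewrite -{2}(fmul1l x) !(fmulC _ x).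
by apply: fmul_le => //; exact: idem_le1.
Qed.

Definition orthogonal_family p := forall i j, i <> j -> p i ** p j = 0.

(** The truncation [t] of [rabs x] by the unit is killed as well, so [1 - t]
    still dominates all the pieces and [t = 0]: [x] is disjoint from the unit,
    hence from itself. *)
Lemma partition_separating p x :
  countable_partition p fone -> (forall n, p n ** x = 0) -> x = 0.
Proof.
move=> [ip _ [_ p_lub]] px; set t := rmeet (rabs x) fone.
have t0 : 0 <= t by rewrite rmeet_ge ?rabs_ge0 ?idem_ge0//; exact: idem1.
have pt n : p n ** t = 0.
  apply/le_anti/andP; split; last by rewrite fmul_ge0// idem_ge0.
  apply: (le_trans (fmul_le (idem_ge0 (ip n)) (rmeetl _ _))).
  by rewrite -rabs_fmul_pos ?idem_ge0// px rabs0.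
have : fone <= fone - t.
  apply: p_lub => _ [n _ <-].
  suff {1}-> : p n = p n ** (fone - t).
    by apply: idem_fmul_le => //; rewrite rsubr_ge0 rmeetr.
  by rewrite fmulBr fmul1r pt subr0.
move=> /(rle_addr (t - fone)); rewrite addrC subrK subrKA subrr => tle0.
have {tle0} t_eq0 : rmeet fone (rabs x) = 0.
  by rewrite rmeetC; apply/le_anti; rewrite tle0.
apply: rabs_eq0; have := fmul_disjoint _ _ _ t_eq0 (rabs_ge0 x).
by rewrite fmul1l rmeet_idl.
Qed.

(** In this form the supremum is replaced by the separating property, which is
    easier to establish and to transport. *)
Lemma partitionP p : countable_partition p fone <->
  [/\ forall n, idem (p n), orthogonal_family p
    & forall x, (forall n, p n ** x = 0) -> x = 0].
Proof.
split=> [pp|[ip op sp]]; first split.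
- by case: pp.
- by case: pp => ip dp _ i j ij; apply/idem_disjointP; auto.
- by move=> x; exact: partition_separating pp.
split=> //; first by move=> i j ij; apply/idem_disjointP; auto.
split=> [_ [n _ <-]|b b_ub]; first exact: idem_le1.
suff : rjoin (fone - b) 0 = 0.
  by move=> h; rewrite -rsubr_ge0 -opprB -oppr0 rle_opp// -h rjoinl.
apply: sp => n; have p0 := idem_ge0 (ip n).
rewrite -fmul_rjoin0// rjoinC rjoin_idl// fmulBr fmul1r.
rewrite -oppr0 -opprB rle_opp// rsubr_ge0 -{1}(ip n).
by apply: fmul_le => //; apply: b_ub; exists n.
Qed.

(** The analogue of a property that holds almost everywhere after the underlying
    space has been cut into countably many parts. *)
Definition piecewise Q := exists2 p, countable_partition p fone
  & forall n, Q (p n).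

Definition hereditary Q := forall u w, idem w -> w ** u = w -> Q u -> Q w.

Lemma piecewise_sub Q Q' :
  (forall u, idem u -> Q u -> Q' u) -> piecewise Q -> piecewise Q'.
Proof. by move=> QQ' [p pp Qp]; exists p => // n; apply: QQ' => //;
  case: pp. Qed.

(** Each piece is cut further by a partition of its own; the products of two
    pieces, enumerated by pairs of integers, partition the unit again. *)
Lemma piecewise_glue p (Q : nat -> set U) : countable_partition p fone ->
  (forall n, hereditary (Q n)) -> (forall n, piecewise (Q n)) ->
  piecewise [set u | exists2 n, u ** p n = u & Q n u].
Proof.
move=> pp hQ pQ; have /card_esym/ppcard_eqP[f] := card_nat2.
have /choice[q Qq] : forall n, exists q : nat -> U,
    countable_partition q fone /\ forall m, Q n (q m).
  by move=> n; have [q] := pQ n; exists q.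
have [ip op sp] := (partitionP p).1 pp.
have hq n := (partitionP (q n)).1 (Qq n).1.
exists (fun k => p (f k).1 ** q (f k).1 (f k).2); last first.
  move=> k; have [iq _ _] := hq (f k).1; exists (f k).1.
    by rewrite fmulAC ip.
  apply: (hQ _ _ _ _ _ ((Qq _).2 (f k).2)); first exact: idemM.
  by rewrite -fmulA iq.
apply/partitionP; split.
- by move=> k; have [iq _ _] := hq (f k).1; exact: idemM.
- move=> i j ij; rewrite fmulACA.
  have [fij|/eqP fij] := eqVneq (f i).1 (f j).1; last by rewrite op// fmul0l.
  rewrite -fij; have [_ oq _] := hq (f i).1; rewrite oq ?fmul0r//.
  move=> fij2; apply: ij; apply: (@inj _ _ setT f); rewrite ?inE//.
  have eq_pair (a b : nat * nat) : a.1 = b.1 -> a.2 = b.2 -> a = b.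
    by move: a b => [? ?] [? ?] /= -> ->.
  exact: eq_pair.
- move=> x fx; apply: sp => n; have [_ _ sq] := hq n; apply: sq => m.
  have [//|k _ fk] := @surj _ _ [set: nat] setT f (n, m).
  by have := fx k; rewrite fk/= fmulA (fmulC (q n m)).
Qed.

Lemma partition1 :
  countable_partition (fun n => if n == 0%N then fone else 0 : U) fone.
Proof.
apply/partitionP; split.
- by case=> [|n]; [exact: idem1|exact: idem0].
- by case=> [|i] [|j]//= _; rewrite ?fmul0l ?fmul0r.
- by move=> x /(_ 0%N); rewrite fmul1l.
Qed.

Lemma piecewise1 Q : hereditary Q -> Q fone -> piecewise Q.
Proof.
move=> hQ Q1; eexists; first exact: partition1.
case=> [//|n].
by apply: (hQ _ _ _ _ Q1); [exact: idem0|rewrite fmul1r].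
Qed.

Lemma piecewiseI Q Q' : hereditary Q -> hereditary Q' ->
  piecewise Q -> piecewise Q' -> piecewise (Q `&` Q').
Proof.
move=> hQ hQ' [p pp Qp] pQ'.
have := piecewise_glue pp (fun=> hQ') (fun=> pQ').
apply: piecewise_sub => u iu [n upn Q'u]; split => //.
exact: (hQ _ _ iu upn (Qp n)).
Qed.

Lemma hereditaryI Q Q' :
  hereditary Q -> hereditary Q' -> hereditary (Q `&` Q').
Proof. by move=> hQ hQ' u w iw wu [? ?]; split;
  [exact: (hQ u)|exact: (hQ' u)]. Qed.

End FAlgebraTheory.

(** * Limits in metric Riesz spaces *)

Section MetricRieszTheory.
Context {R : realType} {W : metricRieszType R}.
Implicit Types (u v w l m : W).

Lemma rdist_ge0 u v : 0 <= rdist u v.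
Proof.
have := @dist_triangle _ _ (@rdist R W) v u u.
rewrite dist_xx (dist_sym _ v u) -mulr2n => h.
by rewrite -(pmulrn_lge0 _ (isT : (0 < 2)%N)).
Qed.

Definition size_of u : R := rdist u 0.

Lemma rdist_size u v : rdist u v = size_of (u - v).
Proof. by rewrite /size_of -(subrr v) rdistD. Qed.

Lemma size_ge0 u : 0 <= size_of u. Proof. exact: rdist_ge0. Qed.

Lemma size0 : size_of 0 = 0. Proof. exact: dist_xx. Qed.

Lemma size_eq0 u : size_of u = 0 -> u = 0. Proof. exact: dist_eq0. Qed.

Lemma size_abs u : size_of (rabs u) = size_of u.
Proof. by rewrite /size_of -rdist_abs. Qed.

Lemma sizeN u : size_of (- u) = size_of u.
Proof. by rewrite -size_abs rabsN size_abs. Qed.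

Lemma size_le u v : rabs u <= v -> size_of u <= size_of v.
Proof. by move=> uv; rewrite -size_abs; apply: rdist_le => //;
  exact: rabs_ge0. Qed.

Lemma sizeD u v : size_of (u + v) <= size_of u + size_of v.
Proof.
have := @dist_triangle _ _ (@rdist R W) v (u + v) 0.
by rewrite (rdist_size (u + v) v) addrK.
Qed.

Section Vanishing.
Context {I : Type} {F : set_system I} {FF : Filter F}.
Implicit Types (f g h : I -> W).

Definition vanishing f := size_of (f i) @[i --> F] --> (0 : R).

Lemma vanishingP f :
  vanishing f <-> forall e, 0 < e -> \forall i \near F, size_of (f i) < e.
Proof.
split=> [/cvgrPdist_lt h e e0|h].
  by have := h e e0; apply: filterS => i;
    rewrite sub0r normrN ger0_norm ?size_ge0.
by apply/cvgrPdist_lt => e e0; have := h e e0; apply: filterS => i;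
  rewrite sub0r normrN ger0_norm ?size_ge0.
Qed.

Lemma vanishing_le g f : (forall i, rabs (f i) <= g i) ->
  vanishing g -> vanishing f.
Proof.
move=> fg /vanishingP gv; apply/vanishingP => e /gv; apply: filterS => i.
by apply: le_lt_trans; exact: size_le.
Qed.

Lemma vanishingD f g :
  vanishing f -> vanishing g -> vanishing (fun i => f i + g i).
Proof.
move=> /vanishingP fv /vanishingP gv; apply/vanishingP => e e0.
have e20 : 0 < e / 2 by rewrite divr_gt0.
have := fv _ e20; have := gv _ e20; apply: filterS2 => i ge fe.
by rewrite (le_lt_trans (sizeD _ _))// [e]splitr ltrD.
Qed.

Lemma vanishing_abs f : vanishing f -> vanishing (fun i => rabs (f i)).
Proof. by apply: cvg_trans; under eq_fun do rewrite size_abs. Qed.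

Lemma vanishingN f : vanishing f -> vanishing (fun i => - f i).
Proof. by apply: cvg_trans; under eq_fun do rewrite sizeN. Qed.

Lemma vanishing0 : vanishing (fun=> 0).
Proof. by apply/vanishingP => e e0; apply: filterE => i; rewrite size0. Qed.

Definition tends f l := vanishing (fun i => f i - l).

Lemma tends_cst l : tends (fun=> l) l.
Proof. by rewrite /tends; under eq_fun do rewrite subrr; exact: vanishing0. Qed.

Lemma tends0 f : tends f 0 <-> vanishing f.
Proof. by rewrite /tends; under eq_fun do rewrite subr0. Qed.

Lemma tendsD f g l m :
  tends f l -> tends g m -> tends (fun i => f i + g i) (l + m).
Proof.
move=> fl gm; have := vanishingD fl gm; rewrite /tends.
by under eq_fun do rewrite addrACA -opprD.
Qed.

Lemma tends_close f g l :
  vanishing (fun i => f i - g i) -> tends g l -> tends f l.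
Proof.
by move=> fg /(vanishingD fg); rewrite /tends; under eq_fun do rewrite subrKA.
Qed.

Lemma tendsN f l : tends f l -> tends (fun i => - f i) (- l).
Proof. by move=> /vanishingN; rewrite /tends;
  under eq_fun do rewrite opprD. Qed.

Lemma tends_abs f l : tends f l -> tends (fun i => rabs (f i)) (rabs l).
Proof.
move=> /vanishing_abs; apply: vanishing_le => i.
exact: (norm_sub_le rabsD rabsN).
Qed.

(** The negative part of the limit is dominated by the distance to [f i]. *)
Lemma tends_ge0 {PF : ProperFilter F} f l :
  (forall i, 0 <= f i) -> tends f l -> 0 <= l.
Proof.
move=> f0 fl; suff n0 : rjoin (- l) 0 = 0.
  by rewrite -oppr0 -[l]opprK rle_opp// -n0 rjoinl.
apply: size_eq0; apply/eqP; rewrite eq_le size_ge0 andbT leNgt;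
  apply/negP => n0.
have [i] := filter_ex ((vanishingP _).1 fl _ n0).
rewrite ltNge => /negP; apply; rewrite -[leRHS]size_abs; apply: size_le.
rewrite ger0_rabs ?rjoinr//; apply: rjoin_le; last exact: rabs_ge0.
by apply: (le_trans _ (rle_abs _)); rewrite -{1}[- l]add0r rle_addr.
Qed.

Lemma tends_le {PF : ProperFilter F} f g l m :
  (forall i, f i <= g i) -> tends f l -> tends g m -> l <= m.
Proof.
move=> fg fl gm; rewrite -rsubr_ge0.
by apply: (tends_ge0 _ (tendsD gm (tendsN fl))) => i; rewrite rsubr_ge0.
Qed.

Lemma tends_unique {PF : ProperFilter F} f l m :
  tends f l -> tends f m -> l = m.
Proof. by move=> fl fm; apply/le_anti; rewrite !(@tends_le _ f f). Qed.

Lemma tends_cvg f l :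
  tends f l -> (f : I -> riesz_space W) @ F --> (l : riesz_space W).
Proof.
move=> /vanishingP fl; apply/cvg_ballP => e e0.
have := fl _ e0; apply: filterS => i; rewrite ballEmdist/= -rdist_size.
by rewrite dist_sym.
Qed.

Lemma cvg_tends f l :
  (f : I -> riesz_space W) @ F --> (l : riesz_space W) -> tends f l.
Proof.
move=> /cvg_ballP fl; apply/vanishingP => e e0.
have := fl _ e0; apply: filterS => i; rewrite ballEmdist/= -rdist_size.
by rewrite dist_sym.
Qed.

End Vanishing.

Arguments vanishing {I} F f.
Arguments tends {I} F f l.

Lemma natSinv_vanishing (v : nat -> W) :
  (forall n, size_of (v n) <= n.+1%:R^-1) -> vanishing \oo v.
Proof.
move=> vn; apply/vanishingP => e e0; near=> n.
apply: le_lt_trans (vn n) _; near: n; exact: near_infty_natSinv_lt (PosNum e0).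
Unshelve. all: by end_near. Qed.

Lemma tends_fst (f : nat -> W) l :
  tends \oo f l -> tends (filter_prod \oo \oo) (fun p => f p.1) l.
Proof. by move=> fl; exact: (cvg_comp _ _ (@cvg_fst nat nat \oo \oo _) fl). Qed.

Lemma tends_snd (f : nat -> W) l :
  tends \oo f l -> tends (filter_prod \oo \oo) (fun p => f p.2) l.
Proof. by move=> fl; exact: (cvg_comp _ _ (@cvg_snd nat nat \oo \oo _) fl). Qed.

Lemma vanishing_pair (f : nat -> W) : vanishing \oo f ->
  vanishing (filter_prod \oo \oo) (fun p => f p.1 + f p.2).
Proof.
move=> /(tends0 _).2 f0; apply: vanishingD.
  by apply/tends0; exact: tends_fst.
by apply/tends0; exact: tends_snd.
Qed.

Lemma vanishing_eq0 I (F : set_system I) {PF : ProperFilter F} u :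
  vanishing F (fun=> u) -> u = 0.
Proof.
by move=> /(tends0 _).2 u0; apply: tends_unique u0; exact: tends_cst.
Qed.

(** Cauchy sequences are expressed by a limit along pairs of indices, so that
    the calculus of limits applies to them. *)
Lemma cauchy_tends (f : nat -> W) :
  vanishing (filter_prod \oo \oo) (fun p => f p.1 - f p.2) ->
  exists l, tends \oo f l.
Proof.
move=> /vanishingP f_cauchy.
have [|l fl] := @rdist_complete R W ((f : nat -> riesz_space W) @ \oo) _.
  apply/cauchy_ballP => e e0.
  have [[A B] [/= hA hB] AB] := f_cauchy _ e0.
  exists (f @` A, f @` B); first split => /=.
  - by apply: filterS hA => n An; exists n.
  - by apply: filterS hB => n An; exists n.
  move=> t [/= [i Ai it] [j Bj jt]]; rewrite -it -jt ballEmdist.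
  by have := AB (i, j) (conj Ai Bj); rewrite /= -rdist_size.
by exists l; exact: cvg_tends.
Qed.

End MetricRieszTheory.
Arguments vanishing {R W I} F f.
Arguments tends {R W I} F f l.

(** * The action of the algebra on the target Riesz space *)

Section RieszEmbedding.
Context {R : realType} {V W : rieszType R} (f : V -> W).
Hypothesis fE : riesz_embedding f.

Lemma remb_lin (a : R) u v : f (a *: u + v) = a *: f u + f v.
Proof. by have [_ + _ _] := fE; apply. Qed.

Lemma rembD u v : f (u + v) = f u + f v.
Proof. by have := remb_lin 1 u v; rewrite !scale1r. Qed.

Lemma remb0 : f 0 = 0.
Proof. by apply/(addrI (f 0)); rewrite -rembD !addr0. Qed.

Lemma rembZ (a : R) u : f (a *: u) = a *: f u.
Proof. by have := remb_lin a u 0; rewrite remb0 !addr0. Qed.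

Lemma rembN u : f (- u) = - f u.
Proof. by rewrite -scaleN1r rembZ scaleN1r. Qed.

Lemma remb_inj : injective f. Proof. by case: fE. Qed.

Lemma remb_le u v : (f u <= f v) = (u <= v).
Proof.
have [_ _ fj _] := fE; apply/idP/idP => h.
  by rewrite -(_ : rjoin v u = v) ?rjoinr//; apply: remb_inj;
    rewrite fj rjoin_idl.
by rewrite -(_ : rjoin (f v) (f u) = f v) ?rjoinr// -fj rjoin_idl.
Qed.

Lemma remb_abs u : f (rabs u) = rabs (f u).
Proof. by have [_ _ fj _] := fE; rewrite /rabs fj rembN. Qed.

End RieszEmbedding.

Section Action.
Context {R : realType} {S : metricFStructure R}.
Local Notation U := (mfs_U S).
Local Notation V := (mfs_V S).
Local Notation iU := (@mfs_inU R S).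
Local Notation iV := (@mfs_inV R S).
Local Notation "u ** v" := (mfs_act u v) (at level 40, left associativity).
Implicit Types (u : U) (v w : V) (p : nat -> U).

Let iVE : riesz_embedding iV := @mfs_inV_embedding R S.
Let iUE : riesz_embedding iU.
Proof. by have [] := @mfs_inU_embedding R S. Qed.
Let iUM u u' : iU (fmul u u') = fmul (iU u) (iU u').
Proof. by have [_ ->] := @mfs_inU_embedding R S. Qed.
Let iU1 : iU fone = fone.
Proof. by have [_ _ ->] := @mfs_inU_embedding R S. Qed.
Let inj := remb_inj iVE.
Let iVM := @mfs_actE R S.

Lemma actDr u v w : u ** (v + w) = u ** v + u ** w.
Proof. by apply: inj; rewrite (rembD iVE) !iVM (rembD iVE) fmulDr. Qed.

Lemma actDl u u' v : (u + u') ** v = u ** v + u' ** v.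
Proof. by apply: inj; rewrite (rembD iVE) !iVM (rembD iUE) fmulDl. Qed.

Lemma actZr (a : R) u v : u ** (a *: v) = a *: (u ** v).
Proof. by apply: inj; rewrite (rembZ iVE) !iVM (rembZ iVE) fmulZr. Qed.

Lemma actZl (a : R) u v : (a *: u) ** v = a *: (u ** v).
Proof. by apply: inj; rewrite (rembZ iVE) !iVM (rembZ iUE) fmulZl. Qed.

Lemma actNr u v : u ** (- v) = - (u ** v).
Proof. by rewrite -scaleN1r actZr scaleN1r. Qed.

Lemma actNl u v : (- u) ** v = - (u ** v).
Proof. by rewrite -scaleN1r actZl scaleN1r. Qed.

Lemma actBr u v w : u ** (v - w) = u ** v - u ** w.
Proof. by rewrite actDr actNr. Qed.

Lemma act0r u : u ** 0 = 0.
Proof. by apply/(addrI (u ** 0)); rewrite -actDr !addr0. Qed.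

Lemma act0l v : 0 ** v = 0.
Proof. by apply/(addrI (0 ** v)); rewrite -actDl !addr0. Qed.

Lemma act1 v : fone ** v = v.
Proof. by apply: inj; rewrite iVM iU1 fmul1l. Qed.

Lemma actA u u' v : u ** (u' ** v) = fmul u u' ** v.
Proof. by apply: inj; rewrite !iVM iUM fmulA. Qed.

Lemma act_ge0 u v : 0 <= u -> 0 <= v -> 0 <= u ** v.
Proof.
rewrite -(remb_le iVE 0) -(remb_le iUE 0) -(remb_le iVE 0) iVM.
by rewrite !(remb0 iVE) (remb0 iUE); exact: fmul_ge0.
Qed.

Lemma act_le u v w : 0 <= u -> v <= w -> u ** v <= u ** w.
Proof. by move=> u0 vw; rewrite -rsubr_ge0 -actBr act_ge0// rsubr_ge0. Qed.

Lemma act_lel u u' v : 0 <= v -> u <= u' -> u ** v <= u' ** v.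
Proof.
by move=> u0 vw; rewrite -rsubr_ge0 -actNl -actDl act_ge0// rsubr_ge0.
Qed.

Lemma act_abs u v : 0 <= u -> rabs (u ** v) = u ** rabs v.
Proof.
move=> u0; apply: inj; rewrite (remb_abs iVE) !iVM rabs_fmul_pos.
  by rewrite (remb_abs iVE).
by rewrite -(remb0 iUE) (remb_le iUE).
Qed.

Lemma act_rjoin0 u v : 0 <= u -> rjoin (u ** v) 0 = u ** rjoin v 0.
Proof.
have [_ _ ij _] := iVE; move=> u0; apply: inj.
rewrite ij !iVM ij (remb0 iVE) fmul_rjoin0//.
by rewrite -(remb0 iUE) (remb_le iUE).
Qed.

Lemma act_idem_le u v : idem u -> 0 <= v -> u ** v <= v.
Proof. by move=> iu v0; rewrite -{2}(act1 v) act_lel// idem_le1. Qed.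

Lemma act_idem u v : idem u -> u ** (u ** v) = u ** v.
Proof. by move=> iu; rewrite actA iu. Qed.

(** The truncation of [rabs v] by the unit, taken in the ambient algebra, lies in
    [U] because [U] is solid, so the separating property of partitions passes
    from [U] to [V]. *)
Lemma act_separating p v :
  countable_partition p fone -> (forall n, p n ** v = 0) -> v = 0.
Proof.
move=> pp pv; have [ip _ _] := pp; apply: rabs_eq0.
set a := iV (rabs v).
have a0 : 0 <= a by rewrite -(remb0 iVE) (remb_le iVE) rabs_ge0.
have one0 : 0 <= (fone : mfs_amb S) := idem_ge0 idem1.
set t := rmeet fone a; have t0 : 0 <= t by rewrite rmeet_ge.
have [s _ st] : range iU t.
  apply: (@mfs_inU_solid _ S (iU fone)); first by exists fone.
  by rewrite iU1 !ger0_rabs// rmeetl.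
have s_eq0 : s = 0.
  apply: (partition_separating pp) => n; have p0 := idem_ge0 (ip n).
  have ip0 : 0 <= iU (p n) by rewrite -(remb0 iUE) (remb_le iUE).
  apply: (remb_inj iUE); rewrite iUM st (remb0 iUE); apply/le_anti/andP.
  split; last by rewrite fmul_ge0.
  apply: (le_trans (fmul_le ip0 (rmeetr _ _))).
  by rewrite /a -iVM -act_abs// pv rabs0 (remb0 iVE).
have ta : rmeet fone a = 0 by rewrite -/t -st s_eq0 (remb0 iUE).
apply: inj; rewrite (remb0 iVE) -/a.
by have := fmul_disjoint _ _ _ ta a0; rewrite fmul1l rmeet_idl.
Qed.

Lemma piecewise_act_eq v w :
  piecewise [set u | u ** v = u ** w] -> v = w.
Proof.
move=> [p pp pvw]; apply/eqP; rewrite -subr_eq0; apply/eqP.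
by apply: (act_separating pp) => n; rewrite actBr pvw subrr.
Qed.

(** The positive part of [v - w] is killed by the pieces. *)
Lemma piecewise_act_le v w :
  piecewise [set u | u ** v <= u ** w] -> v <= w.
Proof.
move=> [p pp pvw]; have [ip _ _] := pp.
suff n0 : rjoin (v - w) 0 = 0.
  suff : v - w <= 0 by rewrite rle_subLR add0r.
  by rewrite -n0 rjoinl.
apply: (act_separating pp) => n; have p0 := idem_ge0 (ip n).
by rewrite -act_rjoin0// actBr rjoinC rjoin_idl// rle_subLR add0r; exact: pvw.
Qed.

(** The glued element is the supremum of the pieces. *)
Lemma act_glue p (v : nat -> V) b : countable_partition p fone ->
    (forall n, 0 <= v n) -> (forall n, p n ** v n <= b) ->
  exists2 s, 0 <= s & forall n, p n ** s = p n ** v n.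
Proof.
move=> pp v0 vb; have [ip op _] := (partitionP p).1 pp.
have [s [s_ub s_lub]] : supremums (range (fun n => p n ** v n)) !=set0.
  apply: (@riesz_dedekind R V).1;
    first by apply: sub_countable (card_image_le _ _) _.
    by exists (p 0%N ** v 0%N); exists 0%N.
  by exists b => _ [n _ <-].
have {}s_ub n : p n ** v n <= s by apply: s_ub; exists n.
have p0 n := idem_ge0 (ip n).
have s0 : 0 <= s by apply: le_trans (s_ub 0%N); exact: act_ge0.
exists s => // m; apply/le_anti/andP; split; last first.
  by rewrite -{1}(ip m) -actA; apply: act_le.
(* Exchanging the m-th piece of s for that of v m leaves an upper bound. *)
have : s <= s - p m ** s + p m ** v m.
  apply: s_lub => _ [n _ <-]; have [->|/eqP nm] := eqVneq n m.
    by rewrite -[leLHS]add0r rle_addr// rsubr_ge0 act_idem_le.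
  rewrite -[leLHS]addr0 rle_add//; last exact: act_ge0.
  have <- : (fone - p m) ** s = s - p m ** s by rewrite actDl actNl act1.
  have -> : p n ** v n = (fone - p m) ** (p n ** v n).
    by rewrite actDl actNl act1 [X in _ - X]actA op ?act0l ?subr0//;
      exact: nesym.
  by apply: act_le => //; rewrite rsubr_ge0 idem_le1.
by rewrite -rsubr_ge0 addrAC (addrAC s) subrr add0r addrC rsubr_ge0.
Qed.

Lemma act_tends I (F : set_system I) {FF : Filter F} (a : I -> U)
    (v : I -> V) u w :
  tends F a u -> tends F v w -> tends F (fun i => a i ** v i) (u ** w).
Proof.
move=> /tends_cvg au /tends_cvg vw; apply: cvg_tends.
exact: (cvg_comp _ _ (cvg_pair au vw) (@mfs_act_continuous R S (u, w))).
Qed.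

Lemma fmul_tends I (F : set_system I) {FF : Filter F} (a b : I -> U) u (w : U) :
  tends F a u -> tends F b w -> tends F (fun i => fmul (a i) (b i)) (fmul u w).
Proof.
move=> /tends_cvg au /tends_cvg vw; apply: cvg_tends.
exact: (cvg_comp _ _ (cvg_pair au vw) (@mfalg_mul_continuous R U (u, w))).
Qed.

Definition scalar_on u (x : U) := exists c : R, fmul u x = c *: u.

(** The elements of [U] that are real numbers on the pieces of some partition.
    They act on step functions with values in a real vector space.
    Partitions are countable here, unlike those of simple elements, so
    that scalars and step functions are cut by the same refinement lemmas. *)
Definition loc_scalar (x : U) := piecewise (scalar_on ^~ x).

Lemma hereditary_scalar_on x : hereditary (scalar_on ^~ x).
Proof.
move=> u w _ wu [c uc]; exists c.
by rewrite -{1}wu -fmulA uc fmulZr wu.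
Qed.

Lemma loc_scalarD x y : loc_scalar x -> loc_scalar y -> loc_scalar (x + y).
Proof.
move=> sx sy; have := piecewiseI (@hereditary_scalar_on x)
  (@hereditary_scalar_on y) sx sy.
apply: piecewise_sub => u _ [[c uc] [d ud]].
by exists (c + d); rewrite fmulDr uc ud scalerDl.
Qed.

Lemma loc_scalarM x y : loc_scalar x -> loc_scalar y -> loc_scalar (fmul x y).
Proof.
move=> sx sy; have := piecewiseI (@hereditary_scalar_on x)
  (@hereditary_scalar_on y) sx sy.
apply: piecewise_sub => u _ [[c uc] [d ud]].
by exists (c * d); rewrite fmulA uc fmulZl ud scalerA.
Qed.

Lemma loc_scalar_real (c : R) : loc_scalar (c *: fone).
Proof.
apply: piecewise1; first exact: hereditary_scalar_on.
by exists c; rewrite fmul1l.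
Qed.

Lemma loc_scalarN x : loc_scalar x -> loc_scalar (- x).
Proof.
move=> sx; have := loc_scalarM (loc_scalar_real (- 1)) sx.
by rewrite fmulZl fmul1l scaleN1r.
Qed.

Lemma simple_loc_scalar : @simple R U `<=` loc_scalar.
Proof.
move=> x [n [a [w [[iw dw w1] ->]]]].
have ow i j : i <> j -> fmul (w i) (w j) = 0.
  by move=> ij; apply/idem_disjointP; auto.
(* A finite partition becomes a countable one by adding zeros. *)
pose p k := if insub k is Some i then w i else 0.
have pw (i : 'I_n) : p i = w i by rewrite /p valK.
exists p; first (apply/partitionP; split).
- by move=> k; rewrite /p; case: insubP => [i _ _//|_]; exact: idem0.
- move=> j k jk; rewrite /p; case: insubP => [i _ ij|_]; last by rewrite fmul0l.
  case: insubP => [i' _ ik|_]; last by rewrite fmul0r.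
  by apply: ow => ii'; apply: jk; rewrite -ij -ik ii'.
- move=> y py; rewrite -(fmul1l y) -w1 fmulC fmul_sumr big1// => i _.
  by rewrite fmulC -pw py.
move=> k; rewrite /scalar_on /p; case: insubP => [i _ _|_]; last first.
  by exists 0; rewrite fmul0l scaler0.
exists (a i); rewrite fmul_sumr (bigD1 i)//= big1 ?addr0; last first.
  by move=> j /eqP ji; rewrite fmulZr ow ?scaler0//; exact: nesym.
by rewrite fmulZr iw.
Qed.

Lemma loc_scalar_dense u :
  exists2 s : nat -> U, (forall n, loc_scalar (s n)) & tends \oo s u.
Proof.
have h (n : nat) : exists2 x, loc_scalar x & size_of (x - u) < n.+1%:R^-1.
  have n0 : 0 < n.+1%:R^-1 :> R by rewrite invr_gt0.
  pose B := ball (u : riesz_space U) n.+1%:R^-1.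
  have [|x [/interior_subset ux sx]] :=
    @mfalg_simple_dense R U B^° _ (open_interior B).
    by exists u; exact: (nbhsx_ballx (u : riesz_space U) _ n0).
  exists x; first exact: simple_loc_scalar.
  by move: ux; rewrite /B ballEmdist/= -rdist_size dist_sym.
have /choice[s hs] : forall n : nat, exists x,
  loc_scalar x /\ size_of (x - u) < n.+1%:R^-1.
  by move=> n; have [x] := h n; exists x.
exists s => [n|]; first by have [] := hs n.
apply/vanishingP => e e0; near=> n.
apply: lt_trans (hs n).2 _; near: n; exact: near_infty_natSinv_lt (PosNum e0).
Unshelve. all: by end_near. Qed.

End Action.

(** * Sequences in normed modules *)

Local Notation "u *| v" := ((u : falg_ring _) *: v) (at level 40).

Section NormedModuleTheory.
Context {R : realType} {S : metricFStructure R} (M : normedModule S).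
Local Notation U := (mfs_U S).
Local Notation V := (mfs_V S).
Local Notation "u ** v" := (mfs_act u v) (at level 40, left associativity).
Local Notation "`|[ x ]|" := (nmod_norm x) (format "`|[ x ]|").
Implicit Types (x y z : M) (u : U).

Lemma nmod_norm0 : `|[(0 : M)]| = 0.
Proof. by apply/nmod_norm_eq0. Qed.

Lemma nmod_normN x : `|[- x]| = `|[x]|.
Proof.
rewrite -[X in `|[- X]|]scale1r -scaleNr nmod_normZ rabsN -nmod_normZ.
by rewrite scale1r.
Qed.

Lemma nmod_norm_tri z x y : `|[x - y]| <= `|[x - z]| + `|[z - y]|.
Proof. by rewrite -(subrKA z) nmod_normD. Qed.

Lemma nmod_normC x y : `|[x - y]| = `|[y - x]|.
Proof. by rewrite -opprB nmod_normN. Qed.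

Lemma rabs_nmod x : rabs `|[x]| = `|[x]|.
Proof. by rewrite ger0_rabs ?nmod_norm_ge0. Qed.

Lemma nmod_norm_sub_le x y : rabs (`|[x]| - `|[y]|) <= `|[x - y]|.
Proof. exact: (norm_sub_le (@nmod_normD _ _ M) nmod_normN). Qed.

Lemma scale_falgN1 x : (- fone : U) *| x = - x.
Proof. exact: scaleN1r. Qed.

Lemma nmod_norm_idem u x : idem u -> `|[u *| x]| = u ** `|[x]|.
Proof. by move=> iu; rewrite nmod_normZ ger0_rabs// idem_ge0. Qed.

Lemma real_linearD (E : lmodType R) (T : E -> M) (e f : E) :
  real_linear T -> T (e + f) = T e + T f.
Proof.
move=> lT; rewrite -[e in LHS]scale1r lT /real_scale.
by rewrite [X in X *| _]scale1r scale1r.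
Qed.

Lemma real_linearZ (E : lmodType R) (T : E -> M) (a : R) (e : E) :
  real_linear T -> T (a *: e) = (a *: (fone : U)) *| T e.
Proof.
move=> lT; rewrite -[LHS]addr0 -[X in _ + X](subrr (T 0)) addrA.
by rewrite -real_linearD// lT addrK.
Qed.

Lemma nmod_ballE (x y : M) e :
  ball (x : nmod_space M) e (y : nmod_space M) = (size_of `|[x - y]| < e) :> Prop.
Proof. by rewrite ballEmdist. Qed.

Lemma nmod_separating (p : nat -> U) x :
  countable_partition p fone -> (forall n, p n *| x = 0) -> x = 0.
Proof.
move=> pp px; have [ip _ _] := pp; apply/nmod_norm_eq0.
by apply: (act_separating pp) => n; rewrite -nmod_norm_idem// px nmod_norm0.
Qed.

Lemma piecewise_nmod_eq x y : piecewise [set u | u *| x = u *| y] -> x = y.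
Proof.
move=> [p pp pxy]; apply/eqP; rewrite -subr_eq0; apply/eqP.
by apply: (nmod_separating pp) => n; rewrite scalerBr pxy subrr.
Qed.

(** Convergence for the distance of the module, expressed in [V]. *)
Definition nmod_tends (a : nat -> M) x := vanishing \oo (fun n => `|[a n - x]|).

Definition nmod_cauchy (a : nat -> M) :=
  vanishing (filter_prod \oo \oo) (fun p => `|[a p.1 - a p.2]|).

Lemma nmod_tends_cst x : nmod_tends (fun=> x) x.
Proof. by rewrite /nmod_tends; under eq_fun do rewrite subrr nmod_norm0;
  exact: vanishing0. Qed.

Lemma nmod_tends_cauchy a x : nmod_tends a x -> nmod_cauchy a.
Proof.
move=> /vanishing_pair; apply: vanishing_le => -[i j] /=; rewrite rabs_nmod.
by rewrite (nmod_normC (a j)) nmod_norm_tri.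
Qed.

Lemma nmod_tends_unique a x y : nmod_tends a x -> nmod_tends a y -> x = y.
Proof.
move=> ax ay; apply/eqP; rewrite -subr_eq0; apply/eqP/nmod_norm_eq0.
apply: (@vanishing_eq0 _ _ _ \oo); apply: vanishing_le (vanishingD ax ay) => n.
by rewrite rabs_nmod (nmod_normC (a n) x) nmod_norm_tri.
Qed.

Lemma nmod_tends_norm a x :
  nmod_tends a x -> tends \oo (fun n => `|[a n]|) `|[x]|.
Proof. by apply: vanishing_le => n; exact: nmod_norm_sub_le. Qed.

Lemma nmod_tendsD a b x y : nmod_tends a x -> nmod_tends b y ->
  nmod_tends (fun n => a n + b n) (x + y).
Proof.
move=> ax bY; apply: vanishing_le (vanishingD ax bY) => n.
by rewrite rabs_nmod opprD addrACA nmod_normD.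
Qed.

Lemma nmod_tendsZ (s : nat -> U) a u x : tends \oo s u -> nmod_tends a x ->
  nmod_tends (fun n => s n *| a n) (u *| x).
Proof.
move=> su ax.
have h1 : vanishing \oo (fun n => rabs (s n - u) ** `|[x]|).
  apply/tends0; rewrite -(act0l `|[x]|) -(@rabs0 R U).
  by apply: act_tends (tends_cst _); apply: tends_abs; apply/tends0.
have h2 : vanishing \oo (fun n => rabs (s n) ** `|[a n - x]|).
  apply/tends0; rewrite -(act0r (rabs u)).
  by apply: act_tends; [exact: tends_abs|apply/tends0].
apply: vanishing_le (vanishingD h2 h1) => n; rewrite rabs_nmod -!nmod_normZ.
apply: (le_trans (nmod_norm_tri (s n *| x) _ _)).
by rewrite -scalerBr -[X in _ + `|[X]|]scalerBl.
Qed.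

Lemma nmod_dense_seq (A : set M) x : dense (A : set (nmod_space M)) ->
  exists2 a : nat -> M, (forall n, A (a n)) & nmod_tends a x.
Proof.
move=> dA; have /choice[a ha] : forall n : nat, exists y,
  A y /\ size_of `|[y - x]| <= n.+1%:R^-1.
  move=> n; have n0 : 0 < n.+1%:R^-1 :> R by rewrite invr_gt0.
  pose B := ball (x : nmod_space M) n.+1%:R^-1.
  have [|y [/interior_subset xy Ay]] := dA B^° _ (open_interior B).
    by exists x; exact: (nbhsx_ballx (x : nmod_space M) _ n0).
  by exists y; split => //; rewrite nmod_normC ltW//; move: xy;
    rewrite /B nmod_ballE.
exists a => [n|]; first by have [] := ha n.
by apply: natSinv_vanishing => n; have [] := ha n.
Qed.

Lemma nmod_dense (A : set M) :
  (forall x, exists2 a : nat -> M, (forall n, A (a n)) & nmod_tends a x) ->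
  dense (A : set (nmod_space M)).
Proof.
move=> h O [x Ox] Oo; have [a Aa /vanishingP ax] := h x.
have /nbhs_ballP[e /= e0 eO] : nbhs (x : nmod_space M) O by apply: open_nbhs_nbhs.
have [n an] := filter_ex (ax _ e0); exists (a n); split => //; apply: eO.
by rewrite nmod_ballE nmod_normC.
Qed.

Lemma complete_nmod_cauchy a : complete_space (nmod_space M) ->
  nmod_cauchy a -> exists x, nmod_tends a x.
Proof.
move=> cM /vanishingP ca.
have [|x ax] := cM ((a : nat -> nmod_space M) @ \oo) _.
  apply/cauchy_ballP => e e0; have [[A B] [/= hA hB] AB] := ca _ e0.
  exists (a @` A, a @` B); first split => /=.
  - by apply: filterS hA => n An; exists n.
  - by apply: filterS hB => n An; exists n.
  move=> t [/= [i Ai it] [j Bj jt]]; rewrite -it -jt nmod_ballE.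
  exact: (AB (i, j) (conj Ai Bj)).
exists x; apply/vanishingP => e e0.
have /cvg_ballP/(_ _ e0) := ax; apply: filterS => n.
by rewrite nmod_ballE nmod_normC.
Qed.

(** A Cauchy filter contains a ball of radius [n.+1%:R^-1] for every [n]; the
    centres of these balls form a Cauchy sequence, whose limit is that of
    the filter. *)
Lemma nmod_cauchy_complete :
  (forall a, nmod_cauchy a -> exists x, nmod_tends a x) ->
  complete_space (nmod_space M).
Proof.
move=> h F PF /cauchyP cF.
have /choice[a Fa] : forall n : nat, exists x : nmod_space M,
  F (ball x n.+1%:R^-1).
  by move=> n; apply: cF; rewrite invr_gt0.
have : nmod_cauchy a.
  apply/vanishingP => e e0; have e20 : 0 < e / 2 by rewrite divr_gt0.
  have small := near_infty_natSinv_lt (PosNum e20).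
  exists ([set n | n.+1%:R^-1 < e / 2], [set n | n.+1%:R^-1 < e / 2]) => //.
  move=> [i j] [/= ie je]; have [y []] := filter_ex (filterI (Fa i) (Fa j)).
  rewrite !nmod_ballE => iy jy.
  rewrite [e]splitr; apply: le_lt_trans (ltrD (lt_trans iy ie) (lt_trans jy je)).
  apply: le_trans (sizeD _ _); apply: size_le; rewrite rabs_nmod.
  by rewrite (nmod_normC (a j)) nmod_norm_tri.
move=> /h[x /vanishingP ax]; exists x; apply/cvg_ballP => e e0.
have e20 : 0 < e / 2 by rewrite divr_gt0.
have [n [nx ne]] := filter_ex (filterI (ax _ e20)
  (near_infty_natSinv_lt (PosNum e20))).
apply: filterS (Fa n) => y; rewrite !nmod_ballE => any.
rewrite [e]splitr; apply: le_lt_trans (ltrD nx (lt_trans any ne)).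
apply: le_trans (sizeD _ _); apply: size_le; rewrite rabs_nmod.
by rewrite (nmod_normC (a n) x) nmod_norm_tri.
Qed.

End NormedModuleTheory.

(** * Completion of a seminormed premodule *)

(** The structure carried by step functions. The laws involving scalars hold
    up to vectors of norm zero, and only for the scalars that are real on
    the pieces of a partition; the completion turns them into module laws
    for all of the algebra. *)
Record premodule (R : realType) (S : metricFStructure R) := Premodule {
  pre_carrier :> zmodType ;
  pre_norm : pre_carrier -> mfs_V S ;
  pre_scal : mfs_U S -> pre_carrier -> pre_carrier ;
  pre_norm_ge0 : forall g, 0 <= pre_norm g ;
  pre_norm0 : pre_norm 0 = 0 ;
  pre_normB : forall g h, pre_norm (g - h) <= pre_norm g + pre_norm h ;
  pre_scalDr : forall s g h, loc_scalar s ->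
    pre_scal s (g + h) = pre_scal s g + pre_scal s h ;
  pre_scalDl : forall s t g, loc_scalar s -> loc_scalar t ->
    pre_norm (pre_scal (s + t) g - (pre_scal s g + pre_scal t g)) = 0 ;
  pre_scalM : forall s t g, loc_scalar s -> loc_scalar t ->
    pre_norm (pre_scal (fmul s t) g - pre_scal s (pre_scal t g)) = 0 ;
  pre_scal1 : forall g, pre_norm (pre_scal fone g - g) = 0 ;
  pre_norm_scal : forall s g, loc_scalar s ->
    pre_norm (pre_scal s g) = mfs_act (rabs s) (pre_norm g) ;
  pre_glue : forall (p : nat -> mfs_U S) (g : nat -> pre_carrier) (b : mfs_V S),
    countable_partition p fone ->
    (forall n, mfs_act (p n) (pre_norm (g n)) <= b) ->
    exists h, forall n, mfs_act (p n) (pre_norm (h - g n)) = 0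
}.

Section PremoduleTheory.
Context {R : realType} {S : metricFStructure R} (G : premodule S).
Local Notation U := (mfs_U S).
Local Notation V := (mfs_V S).
Local Notation N := (@pre_norm R S G).
Local Notation scal := (@pre_scal R S G).
Local Notation "u ** v" := (mfs_act u v) (at level 40, left associativity).
Implicit Types (g h k : G) (s t : U).

Lemma pre_normN g : N (- g) = N g.
Proof.
have le h : N (- h) <= N h.
  by have := pre_normB 0 h; rewrite sub0r pre_norm0 add0r.
by apply/le_anti; rewrite le/= -{1}[g]opprK le.
Qed.

Lemma pre_normD g h : N (g + h) <= N g + N h.
Proof. by have := pre_normB g (- h); rewrite opprK pre_normN. Qed.

Lemma pre_norm_tri k g h : N (g - h) <= N (g - k) + N (k - h).
Proof. by rewrite -(subrKA k) pre_normD. Qed.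

Lemma pre_scalBr s g h : loc_scalar s -> scal s (g - h) = scal s g - scal s h.
Proof. by move=> ls; apply/eqP; rewrite eq_sym subr_eq -pre_scalDr// subrK. Qed.

Lemma pre_norm_scalB s t g : loc_scalar s -> loc_scalar t ->
  N (scal s g - scal t g) <= rabs (s - t) ** N g.
Proof.
move=> ss st; have sB := loc_scalarD ss (loc_scalarN st).
apply: (le_trans (pre_norm_tri (scal (s - t) g + scal t g) _ _)).
have := pre_scalDl g sB st; rewrite subrK => ->.
by rewrite add0r addrK pre_norm_scal.
Qed.

Definition cauchy_seq : {pred nat -> G} := fun a =>
  `[< vanishing (filter_prod \oo \oo) (fun p => N (a p.1 - a p.2)) >].

Lemma rabs_norm g : rabs (N g) = N g.
Proof. by rewrite ger0_rabs// pre_norm_ge0. Qed.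

Lemma cauchy_seq_zmod_closed : zmod_closed cauchy_seq.
Proof.
split=> [|g h /asboolP gc /asboolP hc]; apply/asboolP.
  by under eq_fun do rewrite subrr pre_norm0; exact: vanishing0.
apply: vanishing_le (vanishingD gc hc) => -[i j] /=.
by rewrite rabs_norm opprD addrACA -opprD; exact: pre_normB.
Qed.

HB.instance Definition _ :=
  GRing.isZmodClosed.Build (nat -> G) cauchy_seq cauchy_seq_zmod_closed.

Record cauchy := Cauchy { cauchy_val : nat -> G ;
  _ : cauchy_val \in cauchy_seq }.

HB.instance Definition _ := [isSub for cauchy_val].
HB.instance Definition _ := [Choice of cauchy by <:].
HB.instance Definition _ := [SubChoice_isSubZmodule of cauchy by <:].

Definition null_seq : {pred cauchy} := fun a =>
  `[< vanishing \oo (fun n => N (cauchy_val a n)) >].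

Lemma null_seq_zmod_closed : zmod_closed null_seq.
Proof.
split=> [|g h /asboolP gc /asboolP hc]; apply/asboolP => /=.
  by under eq_fun do rewrite pre_norm0; exact: vanishing0.
by apply: vanishing_le (vanishingD gc hc) => n /=; rewrite rabs_norm pre_normB.
Qed.

HB.instance Definition _ :=
  GRing.isZmodClosed.Build cauchy null_seq null_seq_zmod_closed.

Definition completion : Type := Quotient.quot null_seq.

HB.instance Definition _ := GRing.Zmodule.on completion.

Implicit Types (x y z : completion).

(** Computations in the completion are made on representing sequences. *)
Definition represents (a : nat -> G) (x : completion) : Prop :=
  exists2 h : cauchy, cauchy_val h = a & x = (\pi_(Quotient.quot null_seq) h)%qT.

Lemma represents_ex x : exists a, represents a x.
Proof.
exists (cauchy_val (repr (x : Quotient.quot null_seq))).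
by exists (repr (x : Quotient.quot null_seq)); rewrite ?reprK.
Qed.

Lemma represents_cauchy a x : represents a x ->
  vanishing (filter_prod \oo \oo) (fun p => N (a p.1 - a p.2)).
Proof. by move=> [[b bP] <- _]; exact: (asboolP _ bP). Qed.

Lemma cauchy_represents (a : nat -> G) :
  vanishing (filter_prod \oo \oo) (fun p => N (a p.1 - a p.2)) ->
  exists x, represents a x.
Proof.
move=> ca; have aP : a \in cauchy_seq by apply/asboolP.
by exists (\pi_(Quotient.quot null_seq) (Cauchy aP))%qT; exists (Cauchy aP).
Qed.

Lemma represents_eq a b x y : represents a x -> represents b y ->
  x = y <-> vanishing \oo (fun n => N (a n - b n)).
Proof.
move=> [g <- ->] [h <- ->]; split.
  by move=> /eqP; rewrite -Quotient.idealrBE => /asboolP.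
by move=> gh; apply/eqP; rewrite -Quotient.idealrBE; apply/asboolP.
Qed.

Lemma representsB a b x y : represents a x -> represents b y ->
  represents (fun n => a n - b n) (x - y).
Proof. by move=> [g <- ->] [h <- ->]; exists (g - h); [|rewrite raddfB]. Qed.

Lemma represents0 : represents (fun=> 0) 0.
Proof. by exists 0; [|rewrite raddf0]. Qed.

Lemma representsD a b x y : represents a x -> represents b y ->
  represents (fun n => a n + b n) (x + y).
Proof. by move=> [g <- ->] [h <- ->]; exists (g + h); [|rewrite raddfD]. Qed.

End PremoduleTheory.

Section Completion.
Context {R : realType} {S : metricFStructure R} (G : premodule S).
Local Notation U := (mfs_U S).
Local Notation V := (mfs_V S).
Local Notation N := (@pre_norm R S G).
Local Notation scal := (@pre_scal R S G).
Local Notation "u ** v" := (mfs_act u v) (at level 40, left associativity).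
Implicit Types (g h k : G) (s t : nat -> U) (u : U).
Implicit Types (x y z : completion G) (a b : nat -> G).

Definition completion_norm x : V :=
  xget 0 [set l | exists2 a, represents a x & tends \oo (fun n => N (a n)) l].

Lemma norm_tends_ex a x : represents a x ->
  exists l, tends \oo (fun n => N (a n)) l.
Proof.
move=> ax; apply: cauchy_tends; apply: vanishing_le (represents_cauchy ax).
by move=> -[i j] /=; exact: (norm_sub_le (@pre_normD _ _ G) (@pre_normN _ _ G)).
Qed.

(** The norms along a Cauchy sequence form a Cauchy sequence in [V]. *)
Lemma completion_normP a x : represents a x ->
  tends \oo (fun n => N (a n)) (completion_norm x).
Proof.
move=> ax; have [l al] := norm_tends_ex ax.
rewrite /completion_norm; case: xgetP => [m _ [b bx bm]|/(_ l)[]];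
  last by exists a.
apply: tends_close bm.
apply: vanishing_le ((represents_eq ax bx).1 erefl) => n.
exact: (norm_sub_le (@pre_normD _ _ G) (@pre_normN _ _ G)).
Qed.

Lemma completion_normE a x l : represents a x ->
  tends \oo (fun n => N (a n)) l -> completion_norm x = l.
Proof. by move=> /completion_normP ax al; exact: tends_unique ax al. Qed.

Lemma completion_norm_ge0 x : 0 <= completion_norm x.
Proof.
have [a /completion_normP] := represents_ex x; apply: tends_ge0 => n.
exact: pre_norm_ge0.
Qed.

Lemma completion_norm_eq0 x : completion_norm x = 0 <-> x = 0.
Proof.
have [a ax] := represents_ex x; have := represents_eq ax (represents0 G).
under eq_fun do rewrite subr0; move=> ->; split=> [x0|].
  by have := completion_normP ax; rewrite x0 => /tends0.
by move=> /(tends0 _).2; exact: completion_normE.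
Qed.

Lemma completion_normD x y :
  completion_norm (x + y) <= completion_norm x + completion_norm y.
Proof.
have [a ax] := represents_ex x; have [b bY] := represents_ex y.
apply: tends_le (completion_normP (representsD ax bY))
  (tendsD (completion_normP ax) (completion_normP bY)) => n.
exact: pre_normD.
Qed.

Lemma pre_norm_scal_le (s t : U) g h : loc_scalar s -> loc_scalar t ->
  N (scal s g - scal t h) <= rabs (s - t) ** N g + rabs t ** N (g - h).
Proof.
move=> ss st; apply: (le_trans (pre_norm_tri (scal t g) _ _)); apply: rle_add.
  exact: pre_norm_scalB.
by rewrite -pre_scalBr// pre_norm_scal.
Qed.

(** Joint continuity: scalars with the same limit send equivalent sequences to
    equivalent sequences. Arbitrary filters are allowed so that this also
    gives, along pairs of indices, that the image of a Cauchy sequence is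
    Cauchy. *)
Lemma scal_vanishing I (F : set_system I) {FF : Filter F}
    (s t : I -> U) (a b : I -> G) u l :
  (forall i, loc_scalar (s i)) -> (forall i, loc_scalar (t i)) ->
  tends F s u -> tends F t u -> tends F (fun i => N (a i)) l ->
  vanishing F (fun i => N (a i - b i)) ->
  vanishing F (fun i => N (scal (s i) (a i) - scal (t i) (b i))).
Proof.
move=> ls lt su tu al /(tends0 _).2 ab.
have st : tends F (fun i => s i - t i) 0 by rewrite -(subrr u);
  exact: tendsD su (tendsN tu).
have h1 : vanishing F (fun i => rabs (s i - t i) ** N (a i)).
  apply/tends0; rewrite -(act0l l) -(@rabs0 R U).
  exact: act_tends (tends_abs st) al.
have h2 : vanishing F (fun i => rabs (t i) ** N (a i - b i)).
  by apply/tends0; rewrite -(act0r (rabs u));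
    exact: act_tends (tends_abs tu) ab.
apply: vanishing_le (vanishingD h1 h2) => i; rewrite rabs_norm.
exact: pre_norm_scal_le.
Qed.

Lemma scal_cauchy s a u x : (forall n, loc_scalar (s n)) -> tends \oo s u ->
  represents a x -> exists y, represents (fun n => scal (s n) (a n)) y.
Proof.
move=> ls su ax; apply: cauchy_represents.
apply: (@scal_vanishing _ _ _ (fun p => s p.1) (fun p => s p.2)
  (fun p => a p.1) (fun p => a p.2) u (completion_norm x)) => //.
- exact: tends_fst.
- exact: tends_snd.
- exact: tends_fst (completion_normP ax).
- exact: represents_cauchy ax.
Qed.

(** The limit of [s n * a n] depends only on the limit of [s] in [U] and on
    the class of [a]. *)
Definition completion_scal (u : U) x : completion G :=
  xget 0 [set y | exists s a, [/\ forall n, loc_scalar (s n), tends \oo s u,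
    represents a x & represents (fun n => scal (s n) (a n)) y]].

Lemma completion_scalP s a u x :
  (forall n, loc_scalar (s n)) -> tends \oo s u -> represents a x ->
  represents (fun n => scal (s n) (a n)) (completion_scal u x).
Proof.
move=> ls su ax; have [y sy] := scal_cauchy ls su ax.
suff -> : completion_scal u x = y by [].
rewrite /completion_scal; case: xgetP => [z _|/(_ y)[]]; last by exists s, a.
move=> [t [b [lt tu bx tz]]]; apply/(represents_eq tz sy).
apply: scal_vanishing lt ls tu su (completion_normP bx) _.
exact: (represents_eq bx ax).1.
Qed.

Lemma vanishing_zero (a : nat -> G) : (forall n, N (a n) = 0) ->
  vanishing \oo (fun n => N (a n)).
Proof. by move=> a0; under eq_fun do rewrite a0; exact: vanishing0. Qed.

Lemma completion_scalA u u' x :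
  completion_scal u (completion_scal u' x) = completion_scal (fmul u u') x.
Proof.
have [s ls su] := loc_scalar_dense u; have [t lt tu] := loc_scalar_dense u'.
have [a ax] := represents_ex x.
have h := completion_scalP ls su (completion_scalP lt tu ax).
have h' : represents (fun n => scal (fmul (s n) (t n)) (a n))
    (completion_scal (fmul u u') x).
  by apply: completion_scalP ax => [n|]; [exact: loc_scalarM|exact: fmul_tends].
apply: esym; apply: (represents_eq h' h).2; apply: vanishing_zero => n.
exact: pre_scalM.
Qed.

Lemma completion_scal1 x : completion_scal fone x = x.
Proof.
have [a ax] := represents_ex x.
have l1 : @loc_scalar R S fone by rewrite -[fone]scale1r;
  exact: loc_scalar_real.
have h : represents (fun n => scal fone (a n)) (completion_scal fone x).
  by apply: completion_scalP ax => //; exact: tends_cst.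
by apply: (represents_eq h ax).2; apply: vanishing_zero => n; exact: pre_scal1.
Qed.

Lemma completion_scalDr u x y :
  completion_scal u (x + y) = completion_scal u x + completion_scal u y.
Proof.
have [s ls su] := loc_scalar_dense u.
have [a ax] := represents_ex x; have [b bY] := represents_ex y.
have h := completion_scalP ls su (representsD ax bY).
have h' := representsD (completion_scalP ls su ax) (completion_scalP ls su bY).
apply: (represents_eq h h').2; apply: vanishing_zero => n.
by rewrite pre_scalDr// subrr pre_norm0.
Qed.

Lemma completion_scalDl u u' x :
  completion_scal (u + u') x = completion_scal u x + completion_scal u' x.
Proof.
have [s ls su] := loc_scalar_dense u; have [t lt tu] := loc_scalar_dense u'.
have [a ax] := represents_ex x.
have h : represents (fun n => scal (s n + t n) (a n))
    (completion_scal (u + u') x).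
  by apply: completion_scalP ax => [n|]; [exact: loc_scalarD|exact: tendsD].
have h' := representsD (completion_scalP ls su ax) (completion_scalP lt tu ax).
apply: (represents_eq h h').2; apply: vanishing_zero => n.
exact: pre_scalDl.
Qed.

Lemma completion_norm_scal u x :
  completion_norm (completion_scal u x) = rabs u ** completion_norm x.
Proof.
have [s ls su] := loc_scalar_dense u; have [a ax] := represents_ex x.
apply: (completion_normE (completion_scalP ls su ax)).
under eq_fun do rewrite pre_norm_scal//.
exact: act_tends (tends_abs su) (completion_normP ax).
Qed.

End Completion.

HB.instance Definition _ (R : realType) (S : metricFStructure R)
  (G : premodule S) := GRing.Zmodule_isLmodule.Build (falg_ring (mfs_U S))
    (completion G) (@completion_scalA R S G) (@completion_scal1 R S G)
    (@completion_scalDr R S G) (fun x u u' => @completion_scalDl R S G u u' x).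

(** * The completion as a Banach module *)

Lemma sum_geometric_le (R : realType) (f : nat -> R) (d : R) : 0 <= d ->
  (forall n, 0 <= f n) ->
  (forall n, f n <= d / (2 ^ n.+1)%:R) ->
  (\sum_(0 <= n <oo) (f n)%:E <= d%:E)%E.
Proof.
move=> d0 f0 fd; apply: le_trans (epsilon_trick0 xpredT d0).
by apply: lee_nneseries => n _ *; rewrite lee_fin.
Qed.

Section CompletionModule.
Context {R : realType} {S : metricFStructure R} (G : premodule S).
Local Notation U := (mfs_U S).
Local Notation V := (mfs_V S).
Local Notation N := (@pre_norm R S G).
Local Notation scal := (@pre_scal R S G).
Local Notation "u ** v" := (mfs_act u v) (at level 40, left associativity).
Local Notation "`|[ x ]|" := (completion_norm x) (format "`|[ x ]|").
Implicit Types (g h : G) (u : U) (x y z : completion G) (p : nat -> U).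

Lemma cst_represents g : exists x, represents (fun=> g : G) x.
Proof.
apply: cauchy_represents; under eq_fun do rewrite subrr pre_norm0.
exact: vanishing0.
Qed.

Definition completion_in g : completion G := xget 0 (represents (fun=> g)).

Lemma completion_inP g : represents (fun=> g) (completion_in g).
Proof.
by rewrite /completion_in; case: xgetP => [//|];
  have [x gx] := cst_represents g => /(_ x).
Qed.

Lemma completion_norm_in g : `|[completion_in g]| = N g.
Proof. by apply: (completion_normE (completion_inP g)); exact: tends_cst. Qed.

Lemma completion_inB g h :
  completion_in (g - h) = completion_in g - completion_in h.
Proof.
have gh := representsB (completion_inP g) (completion_inP h).
apply: (represents_eq (completion_inP (g - h)) gh).2;
  apply: vanishing_zero => _.
by rewrite subrr pre_norm0.
Qed.

Lemma completion_inD g h :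
  completion_in (g + h) = completion_in g + completion_in h.
Proof. by apply/eqP; rewrite -subr_eq -completion_inB addrK. Qed.

Lemma completion_in_eq g h : N (g - h) = 0 -> completion_in g = completion_in h.
Proof.
move=> gh; apply: (represents_eq (completion_inP g) (completion_inP h)).2.
exact: vanishing_zero.
Qed.

Lemma completion_in_scal u g : loc_scalar u ->
  (u : falg_ring U) *: completion_in g = completion_in (scal u g).
Proof.
move=> lu;
have h : represents (fun=> scal u g) (completion_scal u (completion_in g)).
  by apply: (completion_scalP _ _ (completion_inP g)) => //; exact: tends_cst.
apply: (represents_eq h (completion_inP _)).2; apply: vanishing_zero => _.
by rewrite subrr pre_norm0.
Qed.

Lemma completion_in_tends (a : nat -> G) x : represents a x ->
  vanishing \oo (fun n => `|[completion_in (a n) - x]|).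
Proof.
move=> ax; apply/vanishingP => e e0; have e20 : 0 < e / 2 by rewrite divr_gt0.
have [[A B] [/= hA hB] AB] := (vanishingP _).1 (represents_cauchy ax) _ e20.
apply: filterS hA => i Ai.
have h := completion_normP (representsB (completion_inP (a i)) ax).
have [j [jh Bj]] := filter_ex (filterI ((vanishingP _).1 h _ e20) hB).
rewrite [e]splitr; apply: le_lt_trans (ltrD jh (AB (i, j) (conj Ai Bj))).
rewrite -(sizeN (_ - _)) opprB; apply: le_trans (sizeD _ _).
by rewrite subrK.
Qed.

Lemma completion_normN x : `|[- x]| = `|[x]|.
Proof.
have [a ax] := represents_ex x.
apply: (completion_normE (a := fun n => 0 - a n)).
  by rewrite -sub0r; exact: representsB (represents0 G) ax.
by under eq_fun do rewrite sub0r pre_normN; exact: completion_normP.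
Qed.

Lemma completion_normC x y : `|[x - y]| = `|[y - x]|.
Proof. by rewrite -opprB completion_normN. Qed.

Lemma completion_norm_tri z x y : `|[x - y]| <= `|[x - z]| + `|[z - y]|.
Proof. by rewrite -(subrKA z) completion_normD. Qed.

Lemma completion_in_dense x e : 0 < e ->
  exists g, size_of `|[x - completion_in g]| < e.
Proof.
move=> e0; have [a /completion_in_tends/vanishingP/(_ _ e0)] := represents_ex x.
by move=> /filter_ex[n an]; exists (a n); rewrite completion_normC.
Qed.

Lemma completion_norm_idem u x : idem u ->
  `|[(u : falg_ring U) *: x]| = u ** `|[x]|.
Proof.
by move=> iu; rewrite [LHS]completion_norm_scal ger0_rabs// idem_ge0.
Qed.

(** A family that is order-bounded piece by piece is glued up to a small error:
    approximate each member by the premodule, closely enough for the errors to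
    be glued in [V] into an element of small size. *)
Lemma completion_glue_approx p (x : nat -> completion G) (b : V) e :
  countable_partition p fone -> (forall n, p n ** `|[x n]| <= b) -> 0 < e ->
  exists h s, size_of s <= e /\ forall n,
    p n ** `|[x n - completion_in h]| <= s.
Proof.
move=> pp xb e0; have [ip _ _] := pp; have [d d0 hd] := mfs_glue pp e0.
have /choice[g xg] : forall n : nat, exists g,
    size_of `|[x n - completion_in g]| < d / (2 ^ n.+1)%:R.
  by move=> n; apply: completion_in_dense; rewrite divr_gt0// ltr0n expn_gt0.
have v0 n : 0 <= `|[x n - completion_in (g n)]| := completion_norm_ge0 _.
have [|_ [s [s_ub _] se]] := hd _ v0.
  apply: sum_geometric_le => [|n|n]; [exact: ltW|exact: size_ge0|].
  apply: le_trans (ltW (xg n)); apply: size_le.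
  by rewrite act_abs ?idem_ge0// ger0_rabs// act_idem_le.
have {}s_ub n : p n ** `|[x n - completion_in (g n)]| <= s.
  by apply: s_ub; exists n.
have [n|h gh] := pre_glue pp (g := g) (b := b + s).
  apply: le_trans (rle_add (xb n) (s_ub n)); rewrite -actDr.
  apply: act_le; first exact: idem_ge0.
  rewrite -completion_norm_in -[X in `|[X]| <= _](subrK (x n)) addrC.
  by rewrite (completion_normC (x n)) completion_normD.
exists h, s; split => // n.
apply: (le_trans _ (s_ub n)); rewrite -[leRHS]addr0 -(gh n) -actDr.
apply: act_le; first exact: idem_ge0.
rewrite -completion_norm_in completion_inB completion_normC.
by rewrite (completion_normC (x n)) [X in _ <= X]addrC completion_norm_tri.
Qed.

(** The approximations of [completion_glue_approx] for the errors [n.+1%:R^-1]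
    are glued step functions [h n], and on each piece both [h i] and [h j]
    are close to the same vector; so [h] is a Cauchy sequence. *)
Lemma completion_glue p (x : nat -> completion G) :
  admissible (@completion_norm R S G) p x ->
  exists y, forall n, (p n : falg_ring U) *: y = (p n : falg_ring U) *: x n.
Proof.
move=> [pp [[b xb] _]]; have [ip _ _] := pp.
have {}xb n : p n ** `|[x n]| <= b.
  by rewrite -completion_norm_idem//; apply: xb; exists n.
have /choice[h /choice[s hs]] : forall n : nat, exists h s,
    size_of s <= n.+1%:R^-1 /\
    forall m, p m ** `|[x m - completion_in h]| <= s.
  by move=> n; apply: completion_glue_approx pp xb _; rewrite invr_gt0.
have sv : vanishing \oo s by apply: natSinv_vanishing => n; have [] := hs n.
have hB i j : N (h i - h j) <= s i + s j.
  apply: piecewise_act_le; exists p => // n /=.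
  rewrite -act_idem//; apply: act_le; first exact: idem_ge0.
  apply: le_trans (rle_add ((hs i).2 n) ((hs j).2 n)); rewrite -actDr.
  apply: act_le; first exact: idem_ge0.
  rewrite -completion_norm_in completion_inB (completion_normC (x n)).
  exact: completion_norm_tri.
have [y hy] : exists y, represents h y.
  apply: cauchy_represents.
  by apply: vanishing_le (vanishing_pair sv) => -[i j]; rewrite rabs_norm.
exists y => n; apply/eqP; rewrite -subr_eq0 -scalerBr; apply/eqP.
apply/completion_norm_eq0; rewrite completion_norm_idem//.
apply: (@vanishing_eq0 _ _ _ \oo).
apply: vanishing_le (vanishingD (completion_in_tends hy) sv) => j.
rewrite act_abs ?idem_ge0// ger0_rabs ?completion_norm_ge0//.
apply: le_trans (rle_add (act_idem_le (ip n) (completion_norm_ge0 _)) ((hs j).2 n)).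
rewrite -actDr; apply: act_le; first exact: idem_ge0.
rewrite (completion_normC _ y) (completion_normC (x n)).
exact: completion_norm_tri.
Qed.

Definition completion_normed : normedModule S :=
  VNormedModule (@completion_norm_ge0 R S G) (@completion_norm_eq0 R S G)
    (@completion_normD R S G) (@completion_norm_scal R S G) completion_glue.

Lemma completion_complete : complete_space (nmod_space completion_normed).
Proof.
apply: nmod_cauchy_complete => a ca.
have /choice[g ag] : forall n : nat, exists g,
    size_of `|[a n - completion_in g]| < n.+1%:R^-1.
  by move=> n; apply: completion_in_dense; rewrite invr_gt0.
have agv : vanishing \oo (fun n => `|[a n - completion_in (g n)]|).
  by apply: natSinv_vanishing => n; exact: ltW.
have [x gx] : exists x, represents g x.
  apply: cauchy_represents.
  apply: vanishing_le (vanishingD ca (vanishing_pair agv)) => -[i j] /=.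
  rewrite rabs_norm -completion_norm_in completion_inB addrCA.
  apply: (le_trans (completion_norm_tri (a i) _ _)).
  rewrite completion_normC; apply: rle_add => //.
  exact: completion_norm_tri.
exists x; apply: vanishing_le (vanishingD agv (completion_in_tends gx)) => n.
by rewrite rabs_nmod; exact: completion_norm_tri.
Qed.

Definition completion_module : banachModule S :=
  VBanachModule completion_complete.

End CompletionModule.

(** * The premodule of a sublinear map *)

Section Germs.
Context {R : realType} {S : metricFStructure R} {E : lmodType R}.
Variable psi : E -> mfs_V S.
Hypothesis psi_ge0 : forall e, 0 <= psi e.
Hypothesis psi_sym : forall e, psi (- e) = psi e.
Hypothesis psi_sub : sublinear psi.
Local Notation U := (mfs_U S).
Local Notation V := (mfs_V S).
Local Notation "u ** v" := (mfs_act u v) (at level 40, left associativity).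
Implicit Types (x y : U -> E) (u w s : U) (e f : E) (v b : V).

Lemma psi0 : psi 0 = 0.
Proof. by have := psi_sub.1 0 0 (lexx 0); rewrite !scale0r. Qed.

Lemma psiZ (a : R) e : psi (a *: e) = `|a| *: psi e.
Proof.
have [a0|/ltW a0] := leP 0 a; first by rewrite ger0_norm// psi_sub.1.
by rewrite -psi_sym -scaleNr psi_sub.1 ?oppr_ge0// ler0_norm.
Qed.

(** [x] takes the value [e] on the piece [u]. Recording the values of [x] on
    all the idempotents below [u] makes this condition hereditary, and
    compatible with pointwise operations, while the value on a nonzero [u]
    is [x u] itself. On [u = 0] every vector is a value, harmlessly since
    only [u ** psi e] matters. *)
Definition germ x u e := forall w, idem w -> w <> 0 -> fmul w u = w -> x w = e.

Definition has_germ x : set U := [set u | exists e, germ x u e].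

Lemma germ_le x u w e : fmul w u = w -> germ x u e -> germ x w e.
Proof.
by move=> wu xe t it t0 tw; apply: xe => //; rewrite -tw -fmulA wu tw.
Qed.

Lemma hereditary_germ x : hereditary (has_germ x).
Proof. by move=> u w _ wu [e xe]; exists e; exact: germ_le xe. Qed.

Lemma germ_psi x u e f : idem u -> germ x u e -> germ x u f ->
  u ** psi e = u ** psi f.
Proof.
move=> iu xe xf; have [->|/eqP u0] := eqVneq u 0; first by rewrite !act0l.
by rewrite -(xe u) ?(xf u).
Qed.

Lemma germD x y u e f : germ x u e -> germ y u f -> germ (x + y) u (e + f).
Proof.
by move=> xe yf w iw w0 wu; rewrite -(xe w iw w0 wu) -(yf w iw w0 wu).
Qed.

Lemma germB x y u e f : germ x u e -> germ y u f -> germ (x - y) u (e - f).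
Proof.
by move=> xe yf w iw w0 wu; rewrite -(xe w iw w0 wu) -(yf w iw w0 wu).
Qed.

(** All the pieces on which [x] is constant are used, rather than those of a
    chosen partition, so that the norm depends on [x] alone. *)
Definition germ_norm x v := forall u e,
  idem u -> germ x u e -> u ** v = u ** psi e.

Definition simple_section x := piecewise (has_germ x) /\ exists v,
  germ_norm x v.

Definition section_norm x : V := xget 0 (germ_norm x).

Lemma section_normP x u e : simple_section x -> idem u -> germ x u e ->
  u ** section_norm x = u ** psi e.
Proof.
move=> [_ [v xv]] iu xe; rewrite /section_norm; case: xgetP => [w _|/(_ v)//].
exact.
Qed.

(** The main tool to build step functions: constant values on the pieces of a
    partition whose norms are bounded by [b] there have a glued norm,
    which is again bounded by [b]. *)
Lemma simple_section_le x b :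
  piecewise [set u | exists2 e, germ x u e & u ** psi e <= u ** b] ->
  simple_section x /\ section_norm x <= b.
Proof.
move=> pb; have b0 : 0 <= b.
  apply: piecewise_act_le; apply: piecewise_sub pb => u iu [e _];
    apply: le_trans.
  by rewrite act0r act_ge0// idem_ge0.
have [p pp hp] := pb; have [ip _ _] := pp.
have /choice[e he] : forall n, exists e,
  germ x (p n) e /\ p n ** psi e <= p n ** b.
  by move=> n; have [e] := hp n; exists e.
have [n|v v0 pv] := act_glue (b := b) pp (fun n => psi_ge0 (e n)).
  exact: le_trans (he n).2 (act_idem_le (ip n) b0).
have sx : simple_section x.
  split; first by exists p => // n; exists (e n); have [] := he n.
  exists v => u f iu xf; apply: piecewise_act_eq; exists p => // n /=.
  rewrite !actA (fmulC _ u) -!actA pv !actA.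
  have iun : idem (fmul u (p n)) by exact: idemM.
  apply: (germ_psi iun); first by apply: germ_le (he n).1; rewrite -fmulA ip.
  by apply: germ_le xf; rewrite fmulAC iu.
split=> //; apply: piecewise_act_le; exists p => // n /=.
by rewrite (section_normP sx (ip n) (he n).1); have [] := he n.
Qed.

Lemma section_norm_ge0 x : simple_section x -> 0 <= section_norm x.
Proof.
move=> sx; apply: piecewise_act_le; apply: piecewise_sub sx.1 => u iu [e xe].
by rewrite /= (section_normP sx iu xe) act0r act_ge0// idem_ge0.
Qed.

(** The laws that hold up to vectors of norm zero all come from this
    criterion. *)
Lemma section_norm_eq0 x : piecewise [set u | germ x u 0] ->
  section_norm x = 0.
Proof.
move=> x0; have [sx le0] : simple_section x /\ section_norm x <= 0.
  apply: simple_section_le; apply: piecewise_sub x0 => u iu xu.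
  by exists 0 => //; rewrite psi0.
by apply/le_anti; rewrite le0 section_norm_ge0.
Qed.

Lemma piecewise_germ2 x y : simple_section x -> simple_section y ->
  piecewise (has_germ x `&` has_germ y).
Proof.
by move=> [px _] [py _]; apply: piecewiseI => //; exact: hereditary_germ.
Qed.

Lemma simple_sectionB x y : simple_section x -> simple_section y ->
  simple_section (x - y) /\
  section_norm (x - y) <= section_norm x + section_norm y.
Proof.
move=> sx sy; apply: simple_section_le.
apply: piecewise_sub (piecewise_germ2 sx sy) => u iu [[e xe] [f yf]].
exists (e - f); first exact: germB.
rewrite actDr (section_normP sx iu xe) (section_normP sy iu yf) -actDr.
by apply: act_le; [exact: idem_ge0|rewrite -(psi_sym f) psi_sub.2].
Qed.

Definition simple_sections : {pred U -> E} := fun x => `[< simple_section x >].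

Lemma simple_sections_zmod_closed : zmod_closed simple_sections.
Proof.
split=> [|x y /asboolP sx /asboolP sy]; apply/asboolP; last first.
  by have [] := simple_sectionB sx sy.
suff : simple_section (0 : U -> E) /\ section_norm 0 <= 0 by case.
apply: simple_section_le; eexists; first exact: partition1.
by move=> n; exists 0 => //; rewrite psi0.
Qed.

HB.instance Definition _ :=
  GRing.isZmodClosed.Build (U -> E) simple_sections simple_sections_zmod_closed.

Record germs := Germs { germs_fun : U -> E ;
  _ : germs_fun \in simple_sections }.

HB.instance Definition _ := [isSub for germs_fun].
HB.instance Definition _ := [Choice of germs by <:].
HB.instance Definition _ := [SubChoice_isSubZmodule of germs by <:].

Implicit Types g h : germs.

Lemma germs_simple g : simple_section (germs_fun g).
Proof. by apply/asboolP; case: g. Qed.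

Definition germs_norm g := section_norm (germs_fun g).

(** The real number is determined by [s] as soon as [w] is nonzero. *)
Definition scalar_value s w : R := xget 0 [set c | fmul w s = c *: w].

Lemma scalar_valueE s u w (c : R) : fmul u s = c *: u ->
  w <> 0 -> fmul w u = w -> scalar_value s w = c.
Proof.
move=> us w0 wu; have ws : fmul w s = c *: w.
  by rewrite -{1}wu -fmulA us fmulZr wu.
rewrite /scalar_value; case: xgetP => [d _ /= wd|/(_ c)//].
move: wd; rewrite ws => /eqP; rewrite -subr_eq0 -scalerBl scaler_eq0 subr_eq0.
by move=> /orP[/eqP//|/eqP].
Qed.

Definition section_scal s x : U -> E := fun w => scalar_value s w *: x w.

Lemma germ_scal s x u e (c : R) : fmul u s = c *: u -> germ x u e ->
  germ (section_scal s x) u (c *: e).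
Proof.
move=> us xe w iw w0 wu; rewrite /section_scal (scalar_valueE us w0 wu).
by rewrite xe.
Qed.

Lemma piecewise_scal s x : loc_scalar s -> simple_section x ->
  piecewise (scalar_on ^~ s `&` has_germ x).
Proof.
move=> ls [px _]; apply: piecewiseI => //; last exact: hereditary_germ.
exact: hereditary_scalar_on.
Qed.

Lemma act_scalar_on u s v (c : R) : idem u -> fmul u s = c *: u ->
  u ** (rabs s ** v) = `|c| *: (u ** v).
Proof.
move=> iu us; rewrite actA -rabs_fmul_pos ?idem_ge0// us rabs_scale.
by rewrite ger0_rabs ?idem_ge0// actZl.
Qed.

Lemma simple_section_scal s x : loc_scalar s -> simple_section x ->
  simple_section (section_scal s x) /\
  section_norm (section_scal s x) = rabs s ** section_norm x.
Proof.
move=> ls sx.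
have [sy _] : simple_section (section_scal s x) /\
    section_norm (section_scal s x) <= rabs s ** section_norm x.
  apply: simple_section_le; apply: piecewise_sub (piecewise_scal ls sx).
  move=> u iu [[c us] [e xe]]; exists (c *: e); first exact: germ_scal.
  by rewrite psiZ actZr (act_scalar_on _ iu us) (section_normP sx iu xe).
split=> //; apply: piecewise_act_eq;
  apply: piecewise_sub (piecewise_scal ls sx).
move=> u iu [[c us] [e xe]] /=; rewrite (section_normP sy iu (germ_scal us xe)).
by rewrite psiZ actZr (act_scalar_on _ iu us) (section_normP sx iu xe).
Qed.

(** The product by a scalar that is not real on pieces need not be a step
    function, whence the default value 0. *)
Definition germs_scal s g : germs := insubd 0 (section_scal s (germs_fun g)).

Lemma germs_scalE s g : loc_scalar s ->
  germs_fun (germs_scal s g) = section_scal s (germs_fun g).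
Proof.
move=> ls; have /asboolP h := (simple_section_scal ls (germs_simple g)).1.
by have := insubdK (0 : germs) h.
Qed.

Lemma germ_cst e u : germ (fun=> e) u e. Proof. by []. Qed.

Lemma cst_simple e : (fun=> e) \in simple_sections.
Proof.
apply/asboolP; have [] // := @simple_section_le (fun=> e) (psi e).
by eexists; [exact: partition1|move=> n; exists e].
Qed.

Definition germs_cst e : germs := Germs (cst_simple e).

Lemma germs_norm_cst e : germs_norm (germs_cst e) = psi e.
Proof.
have := @section_normP _ fone e (germs_simple (germs_cst e)) idem1.
by rewrite !act1; apply; exact: germ_cst.
Qed.

Lemma germs_normB g h : germs_norm (g - h) <= germs_norm g + germs_norm h.
Proof. exact: (simple_sectionB (germs_simple g) (germs_simple h)).2. Qed.

Lemma germs_scalDr s g h : loc_scalar s ->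
  germs_scal s (g + h) = germs_scal s g + germs_scal s h.
Proof.
move=> ls; apply: val_inj => /=; rewrite !germs_scalE//.
by apply/funext => w; exact: scalerDr.
Qed.

Lemma germs_scalDl s t g : loc_scalar s -> loc_scalar t ->
  germs_norm (germs_scal (s + t) g - (germs_scal s g + germs_scal t g)) = 0.
Proof.
move=> ls lt; apply: section_norm_eq0 => /=; rewrite !germs_scalE//;
  last exact: loc_scalarD.
have := piecewiseI (@hereditary_scalar_on _ _ s)
  (hereditaryI (@hereditary_scalar_on _ _ t) (@hereditary_germ (germs_fun g))) ls
  (piecewise_scal lt (germs_simple g)).
apply: piecewise_sub => u iu [[c us] [[d ut] [e ge]]].
have ust : fmul u (s + t) = (c + d) *: u by rewrite fmulDr us ut scalerDl.
have := germB (germ_scal ust ge) (germD (germ_scal us ge) (germ_scal ut ge)).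
by rewrite scalerDl subrr.
Qed.

Lemma germs_scalM s t g : loc_scalar s -> loc_scalar t ->
  germs_norm (germs_scal (fmul s t) g - germs_scal s (germs_scal t g)) = 0.
Proof.
move=> ls lt; apply: section_norm_eq0 => /=; rewrite !germs_scalE//;
  last exact: loc_scalarM.
have := piecewiseI (@hereditary_scalar_on _ _ s)
  (hereditaryI (@hereditary_scalar_on _ _ t) (@hereditary_germ (germs_fun g))) ls
  (piecewise_scal lt (germs_simple g)).
apply: piecewise_sub => u iu [[c us] [[d ut] [e ge]]].
have ust : fmul u (fmul s t) = (c * d) *: u.
  by rewrite fmulA us fmulZl ut scalerA.
have := germB (germ_scal ust ge) (germ_scal us (germ_scal ut ge)).
by rewrite scalerA subrr.
Qed.

Lemma germs_scal1 g : germs_norm (germs_scal fone g - g) = 0.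
Proof.
have l1 : @loc_scalar _ S fone by rewrite -[fone]scale1r;
  exact: loc_scalar_real.
apply: section_norm_eq0 => /=; rewrite germs_scalE//.
apply: piecewise_sub (germs_simple g).1 => u iu [e ge].
have u1 : fmul u fone = (1 : R) *: u by rewrite fmul1r scale1r.
by have := germB (germ_scal u1 ge) ge; rewrite scale1r subrr.
Qed.

Lemma germs_norm_scal s g : loc_scalar s ->
  germs_norm (germs_scal s g) = rabs s ** germs_norm g.
Proof.
move=> ls; rewrite /germs_norm germs_scalE//.
exact: (simple_section_scal ls (germs_simple g)).2.
Qed.

(** On the idempotents below [p n] the glued germ is that of [g n]. *)
Lemma germs_glue (p : nat -> U) (g : nat -> germs) b :
  countable_partition p fone -> (forall n, p n ** germs_norm (g n) <= b) ->
  exists h, forall n, p n ** germs_norm (h - g n) = 0.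
Proof.
move=> pp gb; have [ip op _] := (partitionP p).1 pp.
pose y w := germs_fun (g (xget 0%N [set n | fmul w (p n) = w])) w.
have yE n w : w <> 0 -> fmul w (p n) = w -> y w = germs_fun (g n) w.
  move=> w0 wn; rewrite /y; case: xgetP => [m _ /= wm|/(_ n)//].
  have [->//|/eqP nm] := eqVneq m n; case: w0.
  by rewrite -wn -wm -fmulA op// fmul0r.
have b0 : 0 <= b.
  apply: le_trans (gb 0%N); rewrite act_ge0 ?idem_ge0//.
  exact: section_norm_ge0 (germs_simple _).
have sy : simple_section y.
  have [] // := @simple_section_le y b.
  have := piecewise_glue pp (fun n => @hereditary_germ (germs_fun (g n)))
    (fun n => (germs_simple (g n)).1).
  apply: piecewise_sub => u iu [n un [e ge]]; exists e.
    move=> w iw w0 wu; rewrite (yE n)//; first exact: ge.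
    by rewrite -wu -fmulA un.
  rewrite -(section_normP (germs_simple (g n)) iu ge) -un -!actA.
  apply: act_le; first exact: idem_ge0.
  by rewrite -(act_idem (germs_norm _) (ip n)); apply: act_le;
    rewrite ?idem_ge0.
have /asboolP yP := sy; exists (Germs yP) => n.
apply: piecewise_act_eq; apply: piecewise_sub (germs_simple (g n)).1.
move=> u iu [e ge] /=; have iun : idem (fmul u (p n)) by exact: idemM.
have gun : germ (germs_fun (g n)) (fmul u (p n)) e.
  by apply: germ_le ge; rewrite fmulAC iu.
have yun : germ y (fmul u (p n)) e.
  move=> w iw w0 wun; rewrite (yE n)//; first exact: gun.
  by rewrite -wun -!fmulA ip.
rewrite act0r actA (section_normP (germs_simple _) iun (e := 0)) ?psi0 ?act0r//.
by have := germB yun gun; rewrite subrr.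
Qed.

Lemma germs_norm0 : germs_norm 0 = 0.
Proof. by apply: section_norm_eq0; eexists; first exact: partition1. Qed.

Definition germs_premodule : premodule S :=
  Premodule (fun g => section_norm_ge0 (germs_simple g)) germs_norm0
    germs_normB germs_scalDr germs_scalDl germs_scalM germs_scal1 germs_norm_scal
    germs_glue.

Local Notation M := (completion_module germs_premodule).

Definition canonical_map (e : E) : M :=
  completion_in (germs_cst e : germs_premodule).

Lemma canonical_map_norm e : nmod_norm (canonical_map e) = psi e.
Proof. by rewrite [LHS]completion_norm_in; exact: germs_norm_cst. Qed.

Lemma canonical_map_linear : real_linear canonical_map.
Proof.
move=> a e f; rewrite /real_scale [X in _ = X + _]completion_in_scal;
  last first.
  exact: loc_scalar_real.
rewrite /canonical_map -completion_inD; apply: completion_in_eq.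
apply: section_norm_eq0 => /=; rewrite germs_scalE; last exact: loc_scalar_real.
apply: piecewise1 => [u w _|]; first exact: germ_le.
have u1 : fmul fone (a *: fone) = a *: (fone : U) by rewrite fmul1l.
have := germB (@germ_cst (a *: e + f) fone)
  (germD (germ_scal u1 (@germ_cst e fone)) (@germ_cst f fone)).
by rewrite subrr.
Qed.

(** A step function is the glueing of the vectors that are its values. *)
Lemma canonical_map_dense :
  dense (glueings (range canonical_map) : set (nmod_space M)).
Proof.
apply: nmod_dense => x; have [a ax] := represents_ex x.
exists (fun n => completion_in (a n)); last exact: completion_in_tends.
move=> n; have [[p pp /choice[e pe]] _] := germs_simple (a n).
have [ip op _] := (partitionP p).1 pp.
have eqp m : (p m : falg_ring U) *: (completion_in (a n) : M) =
    (p m : falg_ring U) *: canonical_map (e m).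
  apply/eqP; rewrite -subr_eq0 -scalerBr; apply/eqP/nmod_norm_eq0.
  rewrite nmod_norm_idem// /canonical_map -completion_inB.
  rewrite [X in _ ** X]completion_norm_in.
  rewrite [X in _ ** X]/(section_norm _) (section_normP (germs_simple _) (ip m) (e := 0)).
    by rewrite psi0 act0r.
  by have := germB (pe m) (@germ_cst (e m) (p m)); rewrite subrr.
exists p, (fun m => canonical_map (e m)); split=> [|m|m];
  [|by exists (e m)|exact: eqp].
split=> //; split; last first.
  by exists 0 => _ [m _ <-]; exact: nmod_norm_ge0.
exists (nmod_norm (completion_in (a n) : M)) => _ [m _ <-].
by rewrite -eqp nmod_norm_idem// act_idem_le// nmod_norm_ge0.
Qed.

Lemma sublinear_generates : exists (M : banachModule S) (T : E -> M),
  generated_by psi T.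
Proof.
exists M, canonical_map; split.
- exact: canonical_map_linear.
- exact: canonical_map_norm.
- exact: canonical_map_dense.
Qed.

End Germs.

(** * Uniqueness of the generated module *)

Section Comparison.
Context {R : realType} {S : metricFStructure R} {E : lmodType R}.
Context {M N : banachModule S} (T : E -> M) (T' : E -> N) (psi : E -> mfs_V S).
Hypothesis TG : generated_by psi T.
Hypothesis TG' : generated_by psi T'.
Local Notation U := (mfs_U S).
Local Notation "u ** v" := (mfs_act u v) (at level 40, left associativity).
Local Notation "`|[ x ]|" := (nmod_norm x) (format "`|[ x ]|").
Implicit Types (x y : M) (z t : N) (u s : U) (e f : E).

(** Vectors of the two modules are compared through [E], which is all that the
    modules have in common. *)
Definition same_vector x z : set U :=
  [set u | exists e, u *| x = u *| T e /\ u *| z = u *| T' e].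

Lemma hereditary_same_vector x z : hereditary (same_vector x z).
Proof.
move=> u w _ wu [e [xe ze]]; exists e.
rewrite -(_ : (w : falg_ring U) * u = w)//.
by rewrite -!scalerA xe ze.
Qed.

Definition glued_pair x z := piecewise (same_vector x z).

Lemma glued_pair_norm x z : glued_pair x z -> `|[x]| = `|[z]|.
Proof.
have [_ Tn _] := TG; have [_ Tn' _] := TG'.
move=> xz; apply: piecewise_act_eq; apply: piecewise_sub xz => u iu [e [xe ze]].
by rewrite /= -!nmod_norm_idem// xe ze !nmod_norm_idem// Tn Tn'.
Qed.

Lemma glued_pair_lin s x y z t : loc_scalar s ->
  glued_pair x z -> glued_pair y t -> glued_pair (s *| x + y) (s *| z + t).
Proof.
have [lT _ _] := TG; have [lT' _ _] := TG'; move=> ls xz yt.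
have := piecewiseI (@hereditary_scalar_on _ _ s)
  (hereditaryI (@hereditary_same_vector x z) (@hereditary_same_vector y t)) ls
  (piecewiseI (@hereditary_same_vector x z) (@hereditary_same_vector y t) xz yt).
apply: piecewise_sub => u iu [[c us] [[e [xe ze]] [f [yf tf]]]].
have uc (M' : banachModule S) (m n : M') : u *| m = u *| n ->
    u *| (s *| m) = u *| ((c *: (fone : U)) *| n).
  move=> mn; rewrite !scalerA.
  rewrite -(_ : ((c *: (fone : U)) : falg_ring U) * u = (u : falg_ring U) * s).
    by rewrite [in RHS]mulrC -!scalerA mn.
  by rewrite [LHS](fmulZl c fone u) fmul1l -us.
exists (c *: e + f); rewrite !real_linearD// !real_linearZ// !scalerDr yf tf.
by rewrite (uc _ _ _ xe) (uc _ _ _ ze).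
Qed.

Lemma glued_pairT e : glued_pair (T e) (T' e).
Proof. by eexists; [exact: partition1|move=> n; exists e]. Qed.

(** The images under [T'] of the vectors glued in [M] can be glued in [N], as
    both families have the same norms. *)
Lemma glueings_pair x : glueings (range T) x -> exists z, glued_pair x z.
Proof.
have [_ Tn _] := TG; have [_ Tn' _] := TG'.
move=> [p [v [[pp [[b vb] _]] vT xp]]]; have [ip _ _] := pp.
have /choice[e ve] : forall n, exists e, T e = v n.
  by move=> n; have [e _ <-] := vT n; exists e.
have [|z zp] := @nmod_glue _ _ N p (fun n => T' (e n)).
  split=> //; split; last by exists 0 => _ [n _ <-]; exact: nmod_norm_ge0.
  exists b => _ [n _ <-]; apply: vb; exists n => //.
  by rewrite !nmod_norm_idem// -ve Tn Tn'.
exists z; exists p => // n; exists (e n).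
by rewrite xp zp ve.
Qed.

(** The graph of the isomorphism: the closure of the relation [glued_pair]. *)
Definition limit_pair x z := exists a b,
  [/\ forall n, glued_pair (a n) (b n), nmod_tends a x & nmod_tends b z].

Lemma limit_pair_norm x z : limit_pair x z -> `|[x]| = `|[z]|.
Proof.
move=> [a [b [ab ax bz]]].
apply: tends_unique (nmod_tends_norm ax) _; have := nmod_tends_norm bz.
by under eq_fun do rewrite -(glued_pair_norm (ab _)).
Qed.

Lemma limit_pair_lin u x y z t : limit_pair x z -> limit_pair y t ->
  limit_pair (u *| x + y) (u *| z + t).
Proof.
move=> [a [b [ab ax bz]]] [c [d [cd cy dt]]].
have [s ls su] := loc_scalar_dense u.
exists (fun n => s n *| a n + c n), (fun n => s n *| b n + d n); split.
- by move=> n; exact: glued_pair_lin.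
- by apply: nmod_tendsD cy; exact: nmod_tendsZ.
- by apply: nmod_tendsD dt; exact: nmod_tendsZ.
Qed.

Lemma limit_pairT e : limit_pair (T e) (T' e).
Proof.
exists (fun=> T e), (fun=> T' e).
by split=> [_||]; [exact: glued_pairT|exact: nmod_tends_cst|exact: nmod_tends_cst].
Qed.

Lemma limit_pair_unique x z t : limit_pair x z -> limit_pair x t -> z = t.
Proof.
move=> xz xt; have /limit_pair_norm := limit_pair_lin (- fone) xz xt.
rewrite !scale_falgN1 addNr nmod_norm0 => /esym/nmod_norm_eq0/eqP.
by rewrite addrC subr_eq0 => /eqP.
Qed.

(** A sequence of glueings tending to [x] is Cauchy, hence so is the sequence
    of their partners, because differences of partners are partners and
    have the same norm. *)
Lemma limit_pair_total x : exists z, limit_pair x z.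
Proof.
have [_ _ dT] := TG; have [a aG ax] := nmod_dense_seq x dT.
have /choice[b ab] : forall n, exists z, glued_pair (a n) z.
  by move=> n; exact: glueings_pair.
have [z bz] : exists z, nmod_tends b z.
  apply: complete_nmod_cauchy; first exact: bmod_complete.
  apply: vanishing_le (nmod_tends_cauchy ax) => -[i j] /=; rewrite rabs_nmod.
  have lN1 : @loc_scalar _ S (- fone) by apply: loc_scalarN;
    rewrite -[fone]scale1r; exact: loc_scalar_real.
  have /glued_pair_norm := glued_pair_lin lN1 (ab j) (ab i).
  by rewrite !scale_falgN1 ![- _ + _]addrC => ->.
by exists z, a, b.
Qed.

End Comparison.

Lemma limit_pair_sym (R : realType) (S : metricFStructure R) (E : lmodType R)
    (M N : banachModule S) (T : E -> M) (T' : E -> N) x z :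
  limit_pair T T' x z -> limit_pair T' T z x.
Proof.
move=> [a [b [ab ax bz]]]; exists b, a; split=> // n.
by apply: piecewise_sub (ab n) => u _ [e [? ?]]; exists e.
Qed.

Section Isomorphism.
Context {R : realType} {S : metricFStructure R} {E : lmodType R}.
Context {M N : banachModule S} (T : E -> M) (T' : E -> N) (psi : E -> mfs_V S).
Hypothesis TG : generated_by psi T.
Hypothesis TG' : generated_by psi T'.
Local Notation U := (mfs_U S).

Lemma isomorphism_limit_pair (Phi : M -> N) x z :
  module_isomorphism Phi -> (forall e, Phi (T e) = T' e) ->
  limit_pair T T' x z -> Phi x = z.
Proof.
move=> [lPhi _ nPhi] PhiT [a [b [ab ax bz]]].
have PhiB y y' : Phi (y - y') = Phi y - Phi y'.
  by have := lPhi (- 1) y' y; rewrite !scaleN1r ![- _ + _]addrC.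
have Phi0 : Phi 0 = 0 by rewrite -(subrr 0) PhiB subrr.
have PhiZ u y : Phi (u *| y) = u *| Phi y.
  by have := lPhi u y 0; rewrite Phi0 !addr0.
have Phia n : Phi (a n) = b n.
  apply: piecewise_nmod_eq; apply: piecewise_sub (ab n) => u iu [e [ae be]].
  by rewrite /= -PhiZ ae PhiZ PhiT be.
apply: (nmod_tends_unique (a := b)) => //.
rewrite /nmod_tends; under eq_fun do rewrite -Phia -PhiB nPhi.
exact: ax.
Qed.

(** The relation [limit_pair] is the graph of the isomorphism, and exchanging
    the two modules provides the inverse. *)
Lemma generated_unique : exists! Phi : M -> N,
  module_isomorphism Phi /\ forall e : E, Phi (T e) = T' e.
Proof.
have /choice[Phi hPhi] : forall x, exists z, limit_pair T T' x z.
  exact: limit_pair_total TG TG'.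
have /choice[Psi hPsi] : forall z, exists x, limit_pair T' T z x.
  exact: limit_pair_total TG' TG.
have PhiE x z : limit_pair T T' x z -> Phi x = z.
  by move=> xz; exact: (limit_pair_unique TG TG' (hPhi x) xz).
exists Phi; split; first split; first split.
- move=> u x y; apply: PhiE.
  exact: (limit_pair_lin TG TG').
- exists Psi => [x|z].
    apply: (limit_pair_unique TG' TG (hPsi (Phi x))).
    exact: limit_pair_sym.
  by apply: PhiE; exact: limit_pair_sym.
- by move=> x; rewrite (limit_pair_norm TG TG' (hPhi x)).
- by move=> e; apply: PhiE; exact: limit_pairT.
- move=> Phi' [isoPhi' Phi'T]; apply/funext => x.
  by rewrite (isomorphism_limit_pair isoPhi' Phi'T (hPhi x)).
Qed.

End Isomorphism.

Theorem theorem3p19 (R : realType) (S : metricFStructure R) (E : lmodType R)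
    (psi : E -> mfs_V S)
    (psi_ge0 : forall x : E, 0 <= psi x)
    (psi_symmetric : forall x : E, psi (- x) = psi x)
    (psi_sublinear : sublinear psi) :
  exists (M : banachModule S) (T : E -> M),
    generated_by psi T /\
    forall (N : banachModule S) (T' : E -> N), generated_by psi T' ->
      exists! Phi : M -> N,
        module_isomorphism Phi /\ forall x : E, Phi (T x) = T' x.
Proof.
have [M [T TG]] := sublinear_generates psi_ge0 psi_symmetric psi_sublinear.
by exists M, T; split=> // N T' TG'; exact: generated_unique TG TG'.
Qed.
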